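(* Assume there are constants $\gamma_t\ge 0$ ($t=0,\dots,T-1$) with $|C_t(x)-C_t(y)|\le\gamma_t|x-y|$ for all $x,y$. Then for every $x$ with $z_{k-1}<x\le z_k$, $z_k\in Z_\theta$, $$-\bar\omega_0(z_k)\le v_0(x)-(V_0(x)-c_0x)\le\bar\epsilon_0(z_k).$$
   Context: Model. Fix an integer horizon $T\ge 2$, a discount factor $\alpha\in(0,1]$, and for $t=0,\dots,T-1$: unit ordering costs $c_t\in\mathbb R$, a salvage coefficient $c_T\in\mathbb R$, setup costs $K_t\ge 0$, functions $G_t:\mathbb R\to\mathbb R$, and independent nonnegative random demands $D_0,\dots,D_{T-1}$ with right-continuous distribution functions $F_t$ and finite means; all expectations appearing are assumed finite. Let $\delta(z)=1$ for $z>0$, $\delta(0)=0$. Put $C_t(y)=(c_t-\alpha c_{t+1})y+G_t(y)+\alpha c_{t+1}E[D_t]$. Standing assumptions: (i) each $C_t$ is convex with $C_t(y)\to+\infty$ as $|y|\to\infty$; (ii) $K_t\ge \alpha K_{t+1}$ for $t=0,\dots,T-2$. Optimal costs: $v_T(x)=-c_Tx$, $v_t(x)=\min_{y\ge x}\{K_t\delta(y-x)+c_t(y-x)+G_t(y)+\alpha E[v_{t+1}(y-D_t)]\}$. Grid construction. Fix $\theta>0$, $z_m=m\theta$, $Z_\theta=\{z_m:m\in\mathbb Z\}$, $f_t(n)=F_t(z_{n+1})-F_t(z_n)$ ($n\ge -1$). $C^m_t=\min\{y: C_t(y)=\min_x C_t(x)\}$; with $z_{n_0}<C^m_t\le z_{n_0+1}$,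 $S^U_t=\min\{z_m\in Z_\theta: z_m\ge C^m_t,\ C_t(z_m)>C_t(z_{n_0})+K_t\}$. $s_{T-1}$ is a point with $s_{T-1}\le C^m_{T-1}$, $C_{T-1}(s_{T-1})=C_{T-1}(C^m_{T-1})+K_{T-1}$; $\bar I_{T-1}=s_{T-1}$. For $t=T-2,\dots,0$: $I_t=\max\{z_m\in Z_\theta: z_m<\min(\bar I_{t+1}-\theta,C^m_t)\}$, $\bar I_t=\max\{z_m\in Z_\theta: z_m\le I_t,\ C_t(z_m)>C_t(I_t)+K_t\}+\theta$. $H_{T-1}=C_{T-1}$, $S_{T-1}=C^m_{T-1}$; $V_t(y)=H_t(S_t)+K_t$ for $y<s_t$, $V_t(y)=H_t(y)$ for $y\ge s_t$. For $t=T-2,\dots,0$: $H_t(y)=C_t(y)+\alpha\sum_{n=-1}^\infty V_{t+1}(y-z_n)f_t(n)$; $S_t=\max\{z_m\in Z_\theta: I_t\le z_m\le S^U_t,\ H_t(z_m)=\min\{H_t(z_n):z_n\in Z_\theta, I_t\le z_n\le S^U_t\}\}$; $s_t=S_t$ if $K_t=0$, else $s_t=\min\{z_m\in Z_\theta:\bar I_t\le z_m\le S_t,\ H_t(z_m)\le H_t(S_t)+K_t\}$. Estimate functions. $\psi_{T-1}(x,y)=\bar\psi_{T-1}(x,y)=\gamma_{T-1}x$; $\varphi_{T-1}(x,y)=\bar\varphi_{T-1}(x,y)=0$ if $y<s_{T-1}$ and $=\gamma_{T-1}x$ if $y\ge s_{T-1}$. For $t=0,\dots,T-2$, with $n$ the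 integer such that $z_{n-1}\le y-s_{t+1}<z_n$: $\psi_t(x,y)=\gamma_tx$ if $y<s_{t+1}-\theta$, else $\psi_t(x,y)=\gamma_tx+\alpha\sum_{m=-1}^{n-1}\varphi_{t+1}(x,y-z_m)f_t(m)$; $\varphi_t(x,y)=0$ if $y<s_t$, $=\psi_t(y-s_t,y)$ if $y\ge s_t$ and $y-x<s_t$, $=\psi_t(x,y)$ if $y\ge s_t$ and $y-x\ge s_t$. Likewise $\bar\psi_t(x,y)=\gamma_tx$ if $y<s_{t+1}-\theta$, else $\bar\psi_t(x,y)=\gamma_tx+\alpha\sum_{m=-1}^{n-1}\bar\varphi_{t+1}(x,y-z_m)f_t(m)$; $\bar\varphi_t(x,y)=0$ if $y<s_t$, $=\bar\psi_t(y-s_t+\theta,y)$ if $y\ge s_t$ and $y-x<s_t$, $=\bar\psi_t(x,y)$ if $y\ge s_t$ and $y-x\ge s_t$. Error-bound functions. $\omega_{T-1}\equiv\bar\omega_{T-1}\equiv 0$, $\eta_{T-1}=0$. For $t=T-2,\dots,0$: $\omega_t(x)=\psi_t(\theta,x)-\gamma_t\theta+\alpha\sum_{n=-1}^\infty\bar\omega_{t+1}(x-z_n)f_t(n)$; $\eta_t=\bar\psi_t(\theta,S^U_t)+\omega_t(S^U_t)$; $\bar\omega_t(x)=\eta_t$ if $x\le S^U_t$ and $\bar\omega_t(x)=\max(\eta_t,\omega_t(x))$ if $x>S^U_t$. For $z_k\in Z_\theta$: $\bar\epsilon_{T-2}(z_k)=\alpha\gamma_{T-1}\theta$ and for $t=0,\dots,T-3$,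 $\bar\epsilon_t(z_k)=\alpha^{T-1-t}\gamma_{T-1}\theta+\sum_{i=0}^{T-3-t}2\alpha^i[\bar\psi_{t+i}(\theta,\max(\lambda_t(i),S_{t+i}))-\gamma_{t+i}\theta]$, with $\lambda_t(0)=z_k$, $\lambda_t(i)=\max(\lambda_t(i-1),S_{t+i-1})+\theta$ for $i=1,\dots,T-3-t$. *)

(* Defs.v *)
From mathcomp Require Import all_boot all_order all_algebra.
From mathcomp Require Import all_classical all_reals all_analysis.
Set Implicit Arguments. Unset Strict Implicit. Unset Printing Implicit Defensive.
Import Order.TTheory GRing.Theory Num.Theory.
Local Open Scope ring_scope.
Local Open Scope classical_set_scope.

(* Data of the inventory model (plus the grid size theta and the
   Lipschitz constants gamma_t).  Time indices are natural numbers;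
   the demand D_t is represented by its distribution mu t, a probability
   measure on the Borel sets of R (only the law of D_t enters v_t). *)
Record model (R : realType) := Model {
  mT : nat;
  malpha : R;
  mc : nat -> R;                  (* c_0..c_{T-1}, salvage c_T *)
  mK : nat -> R;
  mG : nat -> R -> R;
  mmu : nat -> probability R R;
  mtheta : R;
  mgamma : nat -> R
}.

Section Defs.
Context {R : realType} (M : model R).
Local Notation T := (mT M).
Local Notation alpha := (malpha M).
Local Notation c := (mc M).
Local Notation K := (mK M).
Local Notation G := (mG M).
Local Notation mu := (mmu M).
Local Notation theta := (mtheta M).
Local Notation gamma := (mgamma M).

Definition Ex (t : nat) (g : R -> R) : R := fine (\int[mu t]_s (g s)%:E).
Definition Fd (t : nat) (x : R) : R := fine (mu t `]-oo, x]).
Definition ssum (u : nat -> R) : R := limn (fun n => \sum_(0 <= j < n) u j).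

Definition delta (x : R) : R := if 0 < x then 1 else 0.

Definition zg (m : int) : R := m%:~R * theta.
Definition isgrid (x : R) : Prop := exists m : int, x = zg m.
Definition fd (t : nat) (n : int) : R := Fd t (zg (n + 1)) - Fd t (zg n).

Definition Cf (t : nat) (y : R) : R :=
  (c t - alpha * c t.+1) * y + G t y + alpha * c t.+1 * Ex t id.

Definition Cm (t : nat) : R := inf [set y | forall x, Cf t y <= Cf t x].
Definition zn0 (t : nat) : R := sup [set w | isgrid w /\ w < Cm t].
Definition SU (t : nat) : R :=
  inf [set w | isgrid w /\ Cm t <= w /\ Cf t (zn0 t) + K t < Cf t w].
Definition sT1 : R :=
  inf [set s | s <= Cm T.-1 /\ Cf T.-1 s = Cf T.-1 (Cm T.-1) + K T.-1].

Definition Vof (H : R -> R) (S s k y : R) : R := if y < s then H S + k else H y.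

Record stage := Stage { stI : R; stIbar : R; stS : R; sts : R; stH : R -> R }.

(* stg k is the stage of time t = T-1-k *)
Fixpoint stg (k : nat) : stage :=
  match k with
  | 0 => Stage sT1 sT1 (Cm T.-1) sT1 (Cf T.-1)
  | k'.+1 =>
    let t := (T - 2 - k')%N in
    let p := stg k' in
    let I := sup [set w | isgrid w /\ w < Num.min (stIbar p - theta) (Cm t)] in
    let Ib := sup [set w | isgrid w /\ w <= I /\ Cf t I + K t < Cf t w] + theta in
    let H := fun y => Cf t y + alpha *
       ssum (fun j => Vof (stH p) (stS p) (sts p) (K t.+1) (y - zg (j%:Z - 1))
                      * fd t (j%:Z - 1)) in
    let S := sup [set w | isgrid w /\ I <= w <= SU t /\
                  forall w', isgrid w' -> I <= w' <= SU t -> H w <= H w'] in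
    let s := if K t == 0 then S
             else inf [set w | isgrid w /\ Ib <= w <= S /\ H w <= H S + K t] in
    Stage I Ib S s H
  end.

Definition It (t : nat) : R := stI (stg (T.-1 - t)).
Definition Ibar (t : nat) : R := stIbar (stg (T.-1 - t)).
Definition St (t : nat) : R := stS (stg (T.-1 - t)).
Definition st (t : nat) : R := sts (stg (T.-1 - t)).
Definition Ht (t : nat) : R -> R := stH (stg (T.-1 - t)).
Definition Vt (t : nat) (y : R) : R := Vof (Ht t) (St t) (st t) (K t) y.

(* estimate functions: psiphi d k = (psi_t, phi_t) for t = T-1-k;
   d = 0 gives (psi, phi), d = theta gives (psibar, phibar) *)
Fixpoint psiphi (d : R) (k : nat) : (R -> R -> R) * (R -> R -> R) :=
  match k with
  | 0 => (fun x _ => gamma T.-1 * x,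
          fun x y => if y < st T.-1 then 0 else gamma T.-1 * x)
  | k'.+1 =>
    let t := (T - 2 - k')%N in
    let ph1 := (psiphi d k').2 in
    let psi := fun x y =>
      if y < st t.+1 - theta then gamma t * x
      else gamma t * x + alpha *
        \sum_(0 <= j < absz (Num.floor ((y - st t.+1) / theta) + 2))
           ph1 x (y - zg (j%:Z - 1)) * fd t (j%:Z - 1) in
    let phi := fun x y =>
      if y < st t then 0
      else if y - x < st t then psi (y - st t + d) y else psi x y in
    (psi, phi)
  end.

Definition psi (t : nat) : R -> R -> R := (psiphi 0 (T.-1 - t)).1.
Definition phi (t : nat) : R -> R -> R := (psiphi 0 (T.-1 - t)).2.
Definition psibar (t : nat) : R -> R -> R := (psiphi theta (T.-1 - t)).1.
Definition phibar (t : nat) : R -> R -> R := (psiphi theta (T.-1 - t)).2.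

(* error-bound functions: omb k = omegabar_t for t = T-1-k *)
Fixpoint omb (k : nat) : R -> R :=
  match k with
  | 0 => fun _ => 0
  | k'.+1 =>
    let t := (T - 2 - k')%N in
    let ob1 := omb k' in
    let omega := fun x => psi t theta x - gamma t * theta +
        alpha * ssum (fun j => ob1 (x - zg (j%:Z - 1)) * fd t (j%:Z - 1)) in
    let eta := psibar t theta (SU t) + omega (SU t) in
    fun x => if x <= SU t then eta else Num.max eta (omega x)
  end.

Definition omegabar (t : nat) : R -> R := omb (T.-1 - t).

Fixpoint lam0 (zk : R) (i : nat) : R :=
  match i with
  | 0 => zk
  | i'.+1 => Num.max (lam0 zk i') (St i') + theta
  end.

(* epsilonbar_0(z_k); for T = 2 the sum is empty and this is alpha*gamma_1*theta *)
Definition epsbar0 (zk : R) : R :=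
  alpha ^+ T.-1 * gamma T.-1 * theta +
  \sum_(0 <= i < T - 2) 2 * alpha ^+ i *
     (psibar i theta (Num.max (lam0 zk i) (St i)) - gamma i * theta).

(* optimal costs: vk k = v_{T-k} *)
Fixpoint vk (k : nat) : R -> R :=
  match k with
  | 0 => fun x => - c T * x
  | k'.+1 =>
    let t := (T - k'.+1)%N in
    fun x => inf [set r | exists2 y, x <= y &
       r = K t * delta (y - x) + c t * (y - x) + G t y
           + alpha * Ex t (fun d => vk k' (y - d))]
  end.

Definition v (t : nat) : R -> R := vk (T - t).

End Defs.

(* Main.v *)
Require Import Defs.
From mathcomp Require Import all_boot all_order all_algebra.
From mathcomp Require Import all_classical all_reals all_analysis.
From mathcomp Require Import ring lra zify.
Set Implicit Arguments. Unset Strict Implicit. Unset Printing Implicit Defensive.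
Import Order.TTheory GRing.Theory Num.Theory.
Import numFieldNormedType.Exports.
Local Open Scope ring_scope.
Local Open Scope classical_set_scope.

(** With [w_t x = v_t x + c_t x] the optimality equation reads
    [w_t x = inf_(y >= x) (K_t delta(y - x) + J_t y)], where
    [J_t y = C_t y + alpha E w_{t+1}(y - D_t)], and [V_t] is compared with [w_t]
    backwards in time.  The grid scheme replaces [D_t] by the lower end of its
    cell, so on the grid [H_t] and [V_t] are K-convex, [S_t] is a global grid
    minimizer of [H_t] and [s_t] separates the grid points where ordering pays.

    Upper bound: apply the policy (s_t, S_t) in the exact problem.  The points
    [y - D_t] and [y - z_n] lie in two adjacent cells, and [V_{t+1}] oscillates
    over a cell by at most [phibar_{t+1}(theta, .)].

    Lower bound: [V_t y - V_t (y - x) <= phi_t(x, y)] bounds [J_t] below by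
    [H_t - omega_t].  An order from [x] up to [y] is compared with the order
    between the lower ends of their cells, where K-convexity applies; an order
    beyond [SU_t] is dominated because [C_t] exceeds [C_t(zn0) + K_t] there. *)

(** * The discretized demand *)

(** The obstacle is that K-convexity survives the recursion only along the grid: shifts by [z_n]
    preserve the grid, but [S_t] minimizes [H_t] over grid points only, which gives no control
    elsewhere. Each comparison at a real point is therefore carried to an end of its cell, and
    [psi], [psibar] measure the price of that move. Demand is rounded down, with [z_(-1) = -theta]
    for zero demand, so the rounded stock can rise by [theta]; hence the margins of [theta] in [It]
    and [lam0]. The term [gamma_t theta] is subtracted in [omega] and [epsbar0] because [C_t] is
    evaluated at the true point and only the expected future cost is discretized. The constant
    [eta_t] is one oscillation of [H_t] over a cell plus the error [omega_t]; monotonicity allows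
    both to be taken at [SU_t] for all order levels up to [SU_t]. In the last stage [V] is exact, so
    all errors arise at earlier times. *)

Section EventuallyConstant.
Context {R : realType}.

(* Every sequence summed against [fd] below is eventually constant, because
   [V_t], [phi_t] and [omegabar_t] are constant near -oo; this reduces [ssum]
   to a finite sum plus a tail probability. *)
Definition evconst (u : nat -> R) : Prop :=
  exists N, forall n, (N <= n)%N -> u n = u N.

Lemma evconst2 u w : evconst u -> evconst w ->
  exists N, (forall n, (N <= n)%N -> u n = u N) /\ (forall n, (N <= n)%N -> w n = w N).
Proof.
move=> [a ua] [b wb]; exists (a + b)%N; split => n abn.
  by rewrite ua ?(ua (a + b)%N) //; lia.
by rewrite wb ?(wb (a + b)%N) //; lia.
Qed.

Lemma evconstD u w : evconst u -> evconst w -> evconst (fun n => u n + w n).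
Proof.
move=> eu ew; have [N [uN wN]] := evconst2 eu ew.
by exists N => n Nn; rewrite uN // wN.
Qed.

Lemma evconstZ c u : evconst u -> evconst (fun n => c * u n).
Proof. by move=> [N uN]; exists N => n Nn; rewrite uN. Qed.

Lemma evconst_cst c : evconst (fun=> c). Proof. by exists 0. Qed.

End EventuallyConstant.

(** * Expectations against sums over demand cells *)

Section Expectation.
Context {R : realType} (M : model R) (t : nat).
Hypothesis theta_gt0 : 0 < mtheta M.
Hypothesis demand_ge0 : mmu M t `]-oo, 0[ = 0%E.

Local Notation z j := (zg M (j%:Z - 1)).
Local Notation f j := (fd M t (j%:Z - 1)).

(* The sums over n >= -1 of the paper, with j = n + 1. *)
Definition gsum (u : nat -> R) : R := ssum (fun j => u j * f j).

Lemma zgD1 (m : int) : zg M (m + 1) = zg M m + mtheta M.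
Proof. by rewrite /zg rmorphD /= mulrDl mul1r. Qed.

Lemma zg_sub1 (m : int) : zg M (m - 1) = zg M m - mtheta M.
Proof. by rewrite /zg rmorphB /= mulrBl mul1r. Qed.

Lemma zgB (m n : int) : zg M (m - n) = zg M m - zg M n.
Proof. by rewrite /zg rmorphB /= mulrBl. Qed.

Lemma zg_lt (m n : int) : (zg M m < zg M n) = (m < n).
Proof. by rewrite /zg ltr_pM2r // ltr_int. Qed.

Lemma zg_le (m n : int) : (zg M m <= zg M n) = (m <= n).
Proof. by rewrite /zg ler_pM2r // ler_int. Qed.

Lemma zgS (j : nat) : z j.+1 = z j + mtheta M.
Proof. by rewrite -zgD1; congr zg; lia. Qed.

Lemma Fd_le x y : x <= y -> Fd M t x <= Fd M t y.
Proof.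
move=> xy; apply: fine_le; rewrite ?fin_num_measure //.
by apply: le_measure; rewrite ?inE //; apply: subset_itvl.
Qed.

Lemma Fd_lt0 x : x < 0 -> Fd M t x = 0.
Proof.
move=> x0; rewrite /Fd; suff -> : mmu M t `]-oo, x] = 0%E by [].
apply/eqP; rewrite eq_le measure_ge0 andbT -demand_ge0.
by apply: le_measure; rewrite ?inE //; apply: subset_itvl; rewrite bnd_simp.
Qed.

Lemma Fd_le1 x : Fd M t x <= 1.
Proof.
rewrite /Fd -[1]/(fine 1%E); apply: fine_le; rewrite ?fin_num_measure //.
exact: probability_le1.
Qed.

Lemma fd_ge0 m : 0 <= fd M t m.
Proof. by rewrite subr_ge0 Fd_le // zgD1 lerDl ltW. Qed.

Lemma Fd_zg_cvg : (fun n : nat => Fd M t (z n)) @ \oo --> (1 : R).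
Proof.
have H := @nondecreasing_cvg_mu _ _ _ (mmu M t) (fun n : nat => `]-oo, z n]).
have cup : \bigcup_n `]-oo, z n] = [set: R].
  apply/seteqP; split=> // x _.
  have [n xn] : exists n : nat, x <= z n.
    exists (Num.truncn `|x / mtheta M|).+2.
    rewrite /zg -ler_pdivrMr //.
    apply: (le_trans (ler_norm _)); apply: ltW; apply: (lt_le_trans (truncnS_gt _)).
    rewrite pmulrn ler_int; move: (Num.Def.trunc _) => m; lia.
  by exists n => //=; rewrite in_itv.
have {}H : (fun n => mmu M t `]-oo, z n]) @ \oo --> (1%:E : \bar R).
  rewrite -((probability_setT (mmu M t))) -cup; apply: H => //.
  - exact: bigcup_measurable.
  - by move=> m n mn; apply/subsetPset; apply: subset_itvl; rewrite bnd_simp zg_le; lia.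
exact: (fine_cvg H).
Qed.

Lemma sum_fd m n : (m <= n)%N -> \sum_(m <= j < n) f j = Fd M t (z n) - Fd M t (z m).
Proof.
move=> mn; rewrite (eq_bigr (fun j => Fd M t (z j.+1) - Fd M t (z j))) ?telescope_sumr //.
by move=> j _; rewrite /fd; congr (Fd M t _ - _); congr zg; lia.
Qed.

Lemma gsum_split u N (c : R) : (forall n, (N <= n)%N -> u n = c) ->
  gsum u = \sum_(0 <= j < N) u j * f j + c * (1 - Fd M t (z N)).
Proof.
move=> uc; apply: cvg_lim => //.
have H1 : (fun n : nat => Fd M t (z n) - Fd M t (z N)) @ \oo --> 1 - Fd M t (z N).
  by apply: cvgB; [exact: Fd_zg_cvg | exact: cvg_cst].
have H2 : (fun n : nat => \sum_(0 <= j < N) u j * f j +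
    c * (Fd M t (z n) - Fd M t (z N))) @ \oo -->
    \sum_(0 <= j < N) u j * f j + c * (1 - Fd M t (z N)).
  by apply: cvgD; [exact: cvg_cst | apply: cvgM; [exact: cvg_cst | exact: H1]].
apply: (cvg_trans _ H2).
apply: near_eq_cvg; near=> n.
have Nn : (N <= n)%N by near: n; exists N.
rewrite -(sum_fd Nn) [RHS](big_cat_nat (n := N)) //=.
congr (_ + _); rewrite mulr_sumr [RHS]big_nat [LHS]big_nat; apply: eq_bigr => j /andP[Nj _].
by rewrite uc.
Unshelve. all: by end_near.
Qed.

Lemma gsum_evconst u N : (forall n, (N <= n)%N -> u n = u N) ->
  gsum u = \sum_(0 <= j < N) u j * f j + u N * (1 - Fd M t (z N)).
Proof. exact: gsum_split. Qed.

Lemma gsum_le u w : evconst u -> evconst w -> (forall n, u n <= w n) -> gsum u <= gsum w.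
Proof.
move=> eu ew uw; have [N [uN wN]] := evconst2 eu ew.
rewrite (gsum_evconst uN) (gsum_evconst wN); apply: lerD.
  by apply: ler_sum => j _; rewrite ler_wpM2r // fd_ge0.
by rewrite ler_wpM2r // subr_ge0 Fd_le1.
Qed.

Lemma gsumD u w : evconst u -> evconst w -> gsum (fun n => u n + w n) = gsum u + gsum w.
Proof.
move=> eu ew; have [N [uN wN]] := evconst2 eu ew.
rewrite (gsum_evconst uN) (gsum_evconst wN) (@gsum_evconst _ N); last by move=> n Nn; rewrite uN // wN.
rewrite (eq_bigr (fun j => u j * f j + w j * f j)) ?big_split /=; first ring.
by move=> j _; ring.
Qed.

Lemma gsumZ c u : evconst u -> gsum (fun n => c * u n) = c * gsum u.
Proof.
move=> [N uN]; rewrite (gsum_evconst uN) (@gsum_evconst _ N); last by move=> n Nn; rewrite uN.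
rewrite [RHS]mulrDr mulr_sumr mulrA; congr (_ + _); apply: eq_bigr => j _; ring.
Qed.

(** The weights have total mass one: the sum starts at [z 0 = -theta], where [Fd] vanishes, so an
    atom of the demand at zero lies in the first cell. *)
Lemma gsum_cst c : gsum (fun=> c) = c.
Proof.
rewrite (@gsum_split _ 0 c) // big_geq // add0r Fd_lt0 ?subr0 ?mulr1 //.
by rewrite /zg sub0r mulN1r oppr_lt0.
Qed.

(** Value [u j] on the cell from [z j] to [z j.+1] for [j < N], and [u N] everywhere else. The
    arbitrary value up to [z 0] sits on a null set. *)
Definition stepf (u : nat -> R) (N : nat) (d : R) : R :=
  u N + \sum_(0 <= j < N) (u j - u N) * \1_(`]z j, z j.+1] : set R) d.

Lemma stepfE u N j d : (forall n, (N <= n)%N -> u n = u N) ->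
  z j < d <= z j.+1 -> stepf u N d = u j.
Proof.
move=> uN jd; rewrite /stepf.
have indE i : \1_(`]z i, z i.+1] : set R) d = (i == j)%:R :> R.
  rewrite indicE; congr ((nat_of_bool _)%:R); apply/idP/idP.
    rewrite inE /= in_itv /= => /andP[id1 di]; move: jd => /andP[jd dj].
    have := lt_le_trans id1 dj; have := lt_le_trans jd di.
    by rewrite !zg_lt; lia.
  by move=> /eqP ->; rewrite inE /= in_itv.
have [jN|Nj] := ltnP j N.
  rewrite (bigD1_seq j) /= ?mem_index_iota ?iota_uniq //.
  rewrite indE eqxx mulr1 big1 ?addr0; last first.
    by move=> i /negPf ij; rewrite indE ij mulr0.
  by ring.
rewrite big_nat big1 ?addr0 ?[in RHS]uN // => i /andP[_ iN].
rewrite indE (_ : (i == j) = false) ?mulr0 //; lia.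
Qed.

Lemma integral_stepf u N :
  (mmu M t).-integrable setT (EFin \o stepf u N) /\
  Ex M t (stepf u N) = u N + \sum_(0 <= j < N) (u j - u N) * f j.
Proof.
pose g n d : R := u N + \sum_(0 <= j < n) (u j - u N) * \1_(`]z j, z j.+1] : set R) d.
suff H n : (mmu M t).-integrable setT (EFin \o g n) /\
  Ex M t (g n) = u N + \sum_(0 <= j < n) (u j - u N) * f j by exact: H.
elim: n => [|n [IHi IHe]].
  have -> : g 0 = cst (u N) by apply/funext => d; rewrite /g big_geq // addr0.
  split; first exact: finite_measure_integrable_cst.
  rewrite big_geq // addr0 /Ex.
  have := @Rintegral_cst _ _ R (mmu M t) setT measurableT (u N).
  by rewrite /Rintegral /= => ->; rewrite probability_setT mulr1.
pose A : set R := `]z n, z n.+1].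
have gS : g n.+1 = (fun d => g n d + (u n - u N) * \1_A d).
  by apply/funext => d; rewrite /g big_nat_recr //= addrA.
have iA : (mmu M t).-integrable setT (EFin \o (\1_A : R -> R)).
  by apply: integrable_indic; exact: measurable_itv.
have iAZ : (mmu M t).-integrable setT (EFin \o (fun d => (u n - u N) * \1_A d)).
  by have := integrableZl measurableT (u n - u N) iA.
split.
  by rewrite gS; have := integrableD measurableT IHi iAZ.
have -> : Ex M t (g n.+1) = Ex M t (g n) + Ex M t (fun d => (u n - u N) * \1_A d).
  by rewrite gS; exact: (RintegralD measurableT IHi iAZ).
rewrite IHe big_nat_recr //= addrA; congr (_ + _).
have -> : Ex M t (fun d => (u n - u N) * \1_A d) = (u n - u N) * Ex M t (\1_A).
  exact: (RintegralZl (u n - u N) measurableT iA).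
have mA : measurable A by exact: measurable_itv.
congr (_ * _); rewrite /Ex integral_indic // (_ : A `&` _ = A); last exact: setIT.
rewrite /fd /Fd.
rewrite (_ : zg M _ = z n.+1); last by congr zg; lia.
have -> : (`]-oo, z n.+1] = `]-oo, z n] `|` A :> set R).
  by rewrite /A -itv_bndbnd_setU // ?bnd_simp // zg_le; lia.
rewrite measureU //; last first.
  apply/seteqP; split => // x [] /=; rewrite !in_itv /= => xn /andP[nx _].
  by move: (lt_le_trans nx xn); rewrite ltxx.
by rewrite fineD ?fin_num_measure //; ring.
Qed.

Lemma Ex_stepf u N : (forall n, (N <= n)%N -> u n = u N) -> Ex M t (stepf u N) = gsum u.
Proof.
move=> uN; rewrite (integral_stepf u N).2 (gsum_evconst uN).
rewrite (eq_bigr (fun j => u j * f j - u N * f j)); last by move=> j _; ring.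
rewrite sumrB -mulr_sumr sum_fd // (@Fd_lt0 (z 0)); first ring.
by rewrite /zg sub0r mulN1r oppr_lt0.
Qed.

Lemma z_cell (d : R) : 0 <= d -> exists j, z j < d <= z j.+1.
Proof.
move=> d0; exists (absz (Num.ceil (d / mtheta M))).
have c0 : 0 <= Num.ceil (d / mtheta M) by rewrite ceil_ge0 (lt_le_trans (ltrN10 _)) // divr_ge0 // ltW.
have /andP[h1 h2] := ceil_itv (d / mtheta M).
rewrite /zg -ltr_pdivlMr // -ler_pdivrMr //.
rewrite (_ : _.+1%:Z - 1 = Num.ceil (d / mtheta M)); last by lia.
by rewrite h2 andbT (_ : _%:Z - 1 = Num.ceil (d / mtheta M) - 1) //; lia.
Qed.

Lemma Ex_mono g h : (mmu M t).-integrable setT (EFin \o g) ->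
  (mmu M t).-integrable setT (EFin \o h) ->
  (forall d, 0 <= d -> g d <= h d) -> Ex M t g <= Ex M t h.
Proof.
move=> ig ih gh.
have ExE k : (mmu M t).-integrable setT (EFin \o k) ->
    Ex M t k = \int[mmu M t]_(x in `[0, +oo[) k x.
  move=> ik; rewrite /Ex /Rintegral; congr fine.
  have -> : `[0, +oo[%classic = [set: R] `\` `]-oo, 0[.
    by rewrite setTD setCitvl.
  apply: negligible_integral => //.
rewrite !ExE //; apply: le_Rintegral => //.
- exact: integrableS ig.
- exact: integrableS ih.
by move=> d /=; rewrite in_itv /= andbT; exact: gh.
Qed.

(** The passage between grid and true demand: a bound that holds on each cell is integrated through
    [stepf]. *)
Lemma gsum_le_Ex u h : evconst u -> (mmu M t).-integrable setT (EFin \o h) ->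
  (forall j d, z j < d <= z j.+1 -> u j <= h d) -> gsum u <= Ex M t h.
Proof.
move=> [N uN] ih uh; rewrite -(Ex_stepf uN); apply: Ex_mono => //.
  exact: (integral_stepf u N).1.
by move=> d /z_cell[j jd]; rewrite (stepfE uN jd); exact: uh jd.
Qed.

Lemma Ex_le_gsum u h : evconst u -> (mmu M t).-integrable setT (EFin \o h) ->
  (forall j d, z j < d <= z j.+1 -> h d <= u j) -> Ex M t h <= gsum u.
Proof.
move=> [N uN] ih uh; rewrite -(Ex_stepf uN); apply: Ex_mono => //.
  exact: (integral_stepf u N).1.
by move=> d /z_cell[j jd]; rewrite (stepfE uN jd); exact: uh jd.
Qed.

End Expectation.

(** * Convex coercive functions *)

Section ConvexCoercive.
Context {R : realType} (f : R -> R) (gam : R).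
Hypothesis gam_ge0 : 0 <= gam.
Hypothesis f_lip : forall x y : R, `|f x - f y| <= gam * `|x - y|.
Hypothesis f_conv : forall x y l : R, 0 <= l <= 1 ->
  f (l * x + (1 - l) * y) <= l * f x + (1 - l) * f y.
Hypothesis f_coer : forall A : R, exists B : R, forall y : R, B <= `|y| -> A <= f y.

Lemma lip_continuous : continuous f.
Proof.
move=> x; apply/cvgrPdist_lt => /= e e0.
have g1 : 0 < gam + 1 by rewrite ltr_pwDr.
apply/nbhs_ballP; exists (e / (gam + 1)); first exact: divr_gt0.
move=> y; rewrite /ball /= ltr_pdivlMr // => xy.
apply: (le_lt_trans (f_lip x y)); have := normr_ge0 ((x : R) - y); nra.
Qed.

Lemma convex_chord (a b c : R) : a <= b <= c ->
  (c - a) * f b <= (c - b) * f a + (b - a) * f c.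
Proof.
move=> /andP[ab bc]; have [ca|ac] := leP c a.
  have -> : b = a by lra.
  have -> : c = a by lra.
  by rewrite subrr !mul0r addr0.
have ca0 : 0 < c - a by rewrite subr_gt0.
pose l := (c - b) / (c - a).
have l01 : 0 <= l <= 1.
  rewrite /l; apply/andP; split; first by apply: divr_ge0; lra.
  by rewrite ler_pdivrMr // mul1r; lra.
have := f_conv a c l01.
have -> : l * a + (1 - l) * c = b by rewrite /l; field; lra.
move=> h; have /le_trans := ler_wpM2l (ltW ca0) h; apply.
by rewrite le_eqVlt; apply/orP; left; apply/eqP; rewrite /l; field; lra.
Qed.

(** Sum of the chord inequalities at the two interior points [a + r] and [b] of [[a, b + r]]. *)
Lemma convex_incr (a b r : R) : a <= b -> 0 <= r -> f (a + r) - f a <= f (b + r) - f b.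
Proof.
move=> ab r0; have [br|br] := leP (b + r) a.
  have -> : b = a by lra.
  by have -> : r = 0 by lra.
have h1 := @convex_chord a (a + r) (b + r) ltac:(lra).
have h2 := @convex_chord a b (b + r) ltac:(lra).
have e : 0 < b + r - a by lra.
rewrite -(ler_pM2l e); nra.
Qed.

Lemma min_exists : exists m : R, forall x, f m <= f x.
Proof.
have [B HB] := f_coer (f 0).
have B0 : - `|B| <= `|B| by rewrite ge0_cp.
have [|m mB Hm] := @EVT_min _ f _ _ B0.
  by apply: continuous_subspaceT; exact: lip_continuous.
exists m => x; have [xB|xB] := leP `|x| `|B|.
  by apply: Hm; rewrite in_itv /= -ler_norml.
apply: (@le_trans _ _ (f 0)).
  by apply: Hm; rewrite in_itv /= oppr_le0 !normr_ge0.
by apply: HB; apply: le_trans (ltW xB); exact: ler_norm.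
Qed.

Lemma lip_le (x y d : R) : `|x - y| <= d -> f x <= f y + gam * d.
Proof.
move=> xy; have := f_lip x y; rewrite ler_norml => /andP[_ h].
have := ler_wpM2l gam_ge0 xy; lra.
Qed.

Lemma le_lip_eps (x y : R) : (forall e : R, 0 < e -> x <= y + gam * e) -> x <= y.
Proof.
move=> h; rewrite leNgt; apply/negP => yx.
have g1 : 0 < gam + 1 by rewrite ltr_pwDr.
have := h ((x - y) / (gam + 1)) ltac:(rewrite divr_gt0 //; lra).
have -> : gam * ((x - y) / (gam + 1)) = (x - y) - (x - y) / (gam + 1) by field; lra.
have : 0 < (x - y) / (gam + 1) by rewrite divr_gt0 //; lra.
lra.
Qed.

(** [Cm] is defined as an infimum; since minimizers come arbitrarily close to it, the Lipschitz
    bound makes it a minimizer itself. *)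
Lemma inf_argmin : forall x, f (inf [set y | forall x, f y <= f x]) <= f x.
Proof.
set A := [set y | _]; move=> x.
have [m Hm] := min_exists.
have hA : has_inf A.
  split; first by exists m.
  have [B HB] := f_coer (f m + 1); exists (- `|B|) => y Ay.
  rewrite leNgt; apply/negP => yB.
  have := HB y; have := Ay m; rewrite ler0_norm; have := normr_ge0 B; have := ler_norm B; lra.
apply: le_lip_eps => e e0.
have [y Ay ye] := inf_adherent e0 hA.
apply: le_trans (lip_le (y := y) (d := e) _) _; last by rewrite lerD2r; exact: Ay.
have : inf A <= y by apply: ge_inf => //; exact: hA.2.
by rewrite ler_norml; lra.
Qed.

Lemma argmin_left (m x y : R) : (forall x, f m <= f x) -> x <= y <= m -> f y <= f x.
Proof.
move=> Hm xym; have := convex_chord xym; have := Hm y; have := Hm x => h1 h2 h3.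
have [] := leP m x => mx; last by nra.
by have -> : y = x by lra.
Qed.

Lemma argmin_right (m x y : R) : (forall x, f m <= f x) -> m <= x <= y -> f x <= f y.
Proof.
move=> Hm mxy; have := convex_chord mxy; have := Hm x; have := Hm y => h1 h2 h3.
have [] := leP y m => mx; last by nra.
by have -> : y = x by lra.
Qed.

Lemma inf_level (m k : R) : (forall x, f m <= f x) -> 0 <= k ->
  let s := inf [set s | s <= m /\ f s = f m + k] in s <= m /\ f s = f m + k.
Proof.
move=> Hm k0; set A := [set s | _]; move=> s.
have [B HB] := f_coer (f m + k).
(* Far enough left for coercivity to lift [f] to the level [f m + k]; the intermediate value theorem
   then gives a point of [A]. *)
pose a := - `|B| - `|m|.
have am : a <= m by rewrite /a; have := ler_normr (- m) m; have := normr_ge0 B; have := ler_norm (- m); rewrite normrN; lra.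
have fa : f m + k <= f a.
  apply: HB; rewrite ler0_norm /a; have := ler_norm B; have := normr_ge0 B; have := normr_ge0 m; lra.
have [||c] := @IVT _ f a m (f m + k) am.
- by apply: continuous_subspaceT; exact: lip_continuous.
- by rewrite ge_min le_max fa /= lerDl k0 orbT.
rewrite in_itv /= => /andP[ac cm] fc.
have hA : has_inf A.
  split; first by exists c.
  have [B' HB'] := f_coer (f m + k + 1); exists (- `|B'|) => y [ym Ay].
  rewrite leNgt; apply/negP => yB.
  have := HB' y; rewrite Ay ler0_norm; have := normr_ge0 B'; have := ler_norm B'; lra.
have clo e : 0 < e -> exists2 y, A y & `|s - y| <= e.
  move=> e0; have [y Ay ye] := inf_adherent e0 hA; exists y => //.
  have : s <= y by apply: ge_inf => //; exact: hA.2.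
  by rewrite ler_norml /s; lra.
split.
  by apply: (le_trans _ cm); apply: ge_inf; [exact: hA.2 | split].
apply/eqP; rewrite eq_le; apply/andP; split; apply: le_lip_eps => e e0.
  have [y [_ fy] sy] := clo e e0; rewrite -fy; exact: lip_le.
have [y [_ fy] sy] := clo e e0; rewrite -fy; apply: lip_le; by rewrite distrC.
Qed.

End ConvexCoercive.

(** * Grid points and K-convexity on a set *)

Section Grid.
Context {R : realType} (M : model R).
Hypothesis theta_gt0 : 0 < mtheta M.
Local Notation theta := (mtheta M).

Lemma grid_gap x y : isgrid M x -> isgrid M y -> x < y -> x + theta <= y.
Proof.
move=> [m ->] [n ->]; rewrite -zgD1 zg_lt // zg_le //; lia.
Qed.

Lemma gridD1 x : isgrid M x -> isgrid M (x + theta).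
Proof. by move=> [m ->]; exists (m + 1); rewrite zgD1. Qed.

Lemma gridB1 x : isgrid M x -> isgrid M (x - theta).
Proof. by move=> [m ->]; exists (m - 1); rewrite zg_sub1. Qed.

Lemma gridBz x m : isgrid M x -> isgrid M (x - zg M m).
Proof. by move=> [n ->]; exists (n - m); rewrite zgB. Qed.

(** An element within [theta] of the supremum must equal it, since distinct grid points are at least
    [theta] apart. This and [grid_inf] turn the [sup] and [inf] of the stage definitions into
    attained extrema. *)
Lemma grid_sup (W : set R) : W `<=` isgrid M -> W !=set0 -> has_ubound W ->
  W (sup W) /\ forall w, W w -> w <= sup W.
Proof.
move=> WG W0 Wb; have hW : has_sup W by [].
have ub w : W w -> w <= sup W by move=> Ww; exact: ub_le_sup.
split => //; have [w Ww wt] := sup_adherent theta_gt0 hW.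
suff -> : sup W = w by [].
apply/eqP; rewrite eq_le (ub _ Ww) andbT; apply: ge_sup => // w' Ww'.
rewrite leNgt; apply/negP => ww'.
by have := grid_gap (WG _ Ww) (WG _ Ww') ww'; have := ub _ Ww'; lra.
Qed.

Lemma grid_inf (W : set R) : W `<=` isgrid M -> W !=set0 -> has_lbound W ->
  W (inf W) /\ forall w, W w -> inf W <= w.
Proof.
move=> WG W0 Wb; have hW : has_inf W by [].
have lb w : W w -> inf W <= w by move=> Ww; exact: ge_inf.
split => //; have [w Ww wt] := inf_adherent theta_gt0 hW.
suff -> : inf W = w by [].
apply/eqP; rewrite eq_le (lb _ Ww) /=; apply: lb_le_inf => // w' Ww'.
rewrite leNgt; apply/negP => ww'.
by have := grid_gap (WG _ Ww') (WG _ Ww) ww'; have := lb _ Ww'; lra.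
Qed.

Lemma grid_cell x : exists2 g, isgrid M g & g - theta < x <= g.
Proof.
exists (zg M (Num.ceil (x / theta))); first by eexists.
have /andP[h1 h2] := ceil_itv (x / theta).
by rewrite -zg_sub1 /zg -ltr_pdivlMr // -ler_pdivrMr // h1.
Qed.

Lemma grid_below x : exists2 g, isgrid M g & g < x.
Proof.
have [g gg /andP[h1 h2]] := grid_cell x.
by exists (g - theta) => //; exact: gridB1.
Qed.

Lemma grid_above x : exists2 g, isgrid M g & x < g.
Proof.
have [g gg /andP[h1 h2]] := grid_cell x.
by exists (g + theta); [exact: gridD1 | lra].
Qed.

End Grid.

(** * Scarf's K-convexity and its preservation by the (s, S) rule *)

Section KConvex.
Context {R : realType}.

(* Scarf's K-convexity with denominators cleared, tested at points of [A] only. *)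
Definition kconvex (A : set R) (k : R) (h : R -> R) : Prop :=
  forall a b c, A a -> A b -> A c -> a < b -> b <= c ->
  (c - b) * (h b - h a) <= (b - a) * (k + h c - h b).

Context (A : set R) (h : R -> R) (S s k : R).
Hypothesis k_ge0 : 0 <= k.
Hypothesis AS : A S.
Hypothesis As : A s.
Hypothesis sS : s <= S.
Hypothesis hS : forall x, A x -> h S <= h x.
Hypothesis hs : h s <= h S + k.
Hypothesis hk : kconvex A k h.

(** If [h b] exceeded [k + h c], it would be too high for the triple [S, b, c] when [b > S], or for
    [s, b, S] when [b <= S]. *)
Lemma kconvex_above b c : A b -> A c -> s <= b -> b <= c -> h b <= k + h c.
Proof.
move=> Ab Ac sb bc; have Sc := hS Ac; have k0 := k_ge0; have hs0 := hs.
have [Sb|bS] := ltP S b.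
  have := hk AS Ab Ac Sb bc; have := hS Ab => h1 h2.
  rewrite leNgt; apply/negP => h3; nra.
have [bs|] := leP b s; first by (have -> : b = s by lra); lra.
move=> sb'; have := hk As Ab AS sb' bS => h2.
rewrite leNgt; apply/negP => h3; nra.
Qed.

Lemma Vof_ge x : A x -> h S <= Vof h S s k x.
Proof. by move=> Ax; rewrite /Vof; case: ifP => _; [rewrite lerDl | exact: hS]. Qed.

Lemma Vof_le_add a b : A a -> A b -> a <= b ->
  Vof h S s k a <= Vof h S s k b + k.
Proof.
move=> Aa Ab ab; have k0 := k_ge0; have Vb := Vof_ge Ab.
rewrite [leLHS]/Vof; case: ifPn => [_|]; first lra.
rewrite -leNgt => sa; rewrite /Vof ifF; last by apply/negbTE; rewrite -leNgt; lra.
by rewrite addrC; apply: kconvex_above.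
Qed.

Lemma kconvex_Vof : kconvex A k (Vof h S s k).
Proof.
move=> a b c Aa Ab Ac ab bc; have Sc := hS Ac; have Sb := hS Ab.
have k0 := k_ge0; have sS0 := sS.
rewrite /Vof; have [a_s|sa] := ltP a s; last first.
  rewrite !ifF; [exact: hk | |]; by apply/negbTE; rewrite -leNgt; lra.
have [bs|sb] := ltP b s.
  rewrite subrr mulr0; have [cs|sc] := ltP c s; first by nra.
  by apply: mulr_ge0; lra.
rewrite ifF; last by apply/negbTE; rewrite -leNgt; lra.
have h1 := kconvex_above Ab Ac sb bc.
have [hb|hb] := leP (h b) (h S + k); first by nra.
(* When [h b] exceeds [h S + k], the point [b] lies beyond [S], and K-convexity of [h] at [S, b, c]
   yields the inequality at [a, b, c] because [a < s <= S]. *)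
have Slb : S < b.
  rewrite ltNge; apply/negP => bS; have := kconvex_above Ab AS sb bS; lra.
have h2 := hk AS Ab Ac Slb bc.
have h3 : (b - S) * (k + h c - h b) <= (b - a) * (k + h c - h b).
  by rewrite ler_wpM2r //; lra.
apply: le_trans h3; apply: le_trans h2; rewrite ler_wpM2l //; lra.
Qed.

End KConvex.

(** * The stages of the grid scheme *)

Record admissible {R : realType} (M : model R) : Prop := Admissible {
  adm_T : (2 <= mT M)%N;
  adm_alpha : 0 < malpha M <= 1;
  adm_K : forall t, (t < mT M)%N -> 0 <= mK M t;
  adm_demand : forall t, (t < mT M)%N -> mmu M t `]-oo, 0[ = 0%E;
  adm_mean : forall t, (t < mT M)%N -> (mmu M t).-integrable setT (fun s => s%:E);
  adm_int : forall t y, (t < mT M)%N ->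
     (mmu M t).-integrable setT (fun s => (v M t.+1 (y - s))%:E);
  adm_conv : forall t, (t < mT M)%N -> forall x y l, 0 <= l <= 1 ->
     Cf M t (l * x + (1 - l) * y) <= l * Cf M t x + (1 - l) * Cf M t y;
  adm_coer : forall t, (t < mT M)%N -> forall A, exists B, forall y,
     B <= `|y| -> A <= Cf M t y;
  adm_KK : forall t, (t.+2 <= mT M)%N -> mK M t >= malpha M * mK M t.+1;
  adm_theta : 0 < mtheta M;
  adm_gamma : forall t, (t < mT M)%N -> 0 <= mgamma M t;
  adm_lip : forall t, (t < mT M)%N -> forall x y,
     `|Cf M t x - Cf M t y| <= mgamma M t * `|x - y|
}.

Section Stages.
Context {R : realType} (M : model R) (adm : admissible M).
Local Notation T := (mT M).
Local Notation alpha := (malpha M).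
Local Notation K := (mK M).
Local Notation theta := (mtheta M).
Local Notation gamma := (mgamma M).
Local Notation z j := (zg M (j%:Z - 1)).

Let th0 : 0 < theta := adm_theta adm.

Lemma alpha_ge0 : 0 <= alpha.
Proof. by have /andP[/ltW] := adm_alpha adm. Qed.

Lemma back_ind (P : nat -> Prop) : P T.-1 ->
  (forall t, (t.+1 < T)%N -> P t.+1 -> P t) -> forall t, (t < T)%N -> P t.
Proof.
move=> P0 PS t tT; have := adm_T adm => T2.
have -> : t = (T.-1 - (T.-1 - t))%N by lia.
elim: (T.-1 - t)%N => [|n IH]; first by rewrite subn0.
have [nT|Tn] := ltnP n T.-1; last by rewrite (_ : (T.-1 - n.+1 = T.-1 - n)%N) //; lia.
apply: PS; first by lia.
by rewrite (_ : (T.-1 - n.+1).+1 = (T.-1 - n)%N) //; lia.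
Qed.

(** * The one-period cost and the points [Cm], [zn0], [SU] *)

Section Cost.
Context (t : nat) (tT : (t < T)%N).

Lemma Cm_min x : Cf M t (Cm M t) <= Cf M t x.
Proof. exact: (inf_argmin (adm_gamma adm tT) (adm_lip adm tT) (adm_coer adm tT)). Qed.

Lemma Cf_left x y : x <= y <= Cm M t -> Cf M t y <= Cf M t x.
Proof. exact: (argmin_left (adm_conv adm tT) Cm_min). Qed.

Lemma Cf_right x y : Cm M t <= x <= y -> Cf M t x <= Cf M t y.
Proof. exact: (argmin_right (adm_conv adm tT) Cm_min). Qed.

Lemma zn0_spec : [/\ isgrid M (zn0 M t), zn0 M t < Cm M t &
  forall w, isgrid M w -> w < Cm M t -> w <= zn0 M t].
Proof.
have [|||[h1 h2] h3] := @grid_sup _ M th0 [set w | isgrid M w /\ w < Cm M t].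
- by move=> w [].
- by have [g gg gC] := grid_below th0 (Cm M t); exists g.
- by exists (Cm M t) => w [_ /ltW].
by split => // w gw wC; exact: h3.
Qed.

Lemma SU_spec : [/\ isgrid M (SU M t), Cm M t <= SU M t &
  Cf M t (zn0 M t) + K t < Cf M t (SU M t)].
Proof.
have [|||[h1 [h2 h3]] _] := @grid_inf _ M th0
  [set w | isgrid M w /\ Cm M t <= w /\ Cf M t (zn0 M t) + K t < Cf M t w].
- by move=> w [].
- have [B HB] := adm_coer adm tT (Cf M t (zn0 M t) + K t + 1).
  have [g gg gC] := grid_above th0 (Num.max (Cm M t) B); move: gC; rewrite gt_max => /andP[gC gB].
  exists g; split => //; split; first exact: ltW.
  by have := HB g (le_trans (ltW gB) (ler_norm _)); lra.
- by exists (Cm M t) => w [_ []].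
by [].
Qed.

Lemma zn0_SU : zn0 M t < SU M t.
Proof. by have [_ h1 _] := zn0_spec; have [_ h2 _] := SU_spec; exact: lt_le_trans h2. Qed.

Lemma Cf_after_SU y : SU M t <= y -> Cf M t (zn0 M t) + K t < Cf M t y.
Proof.
move=> Sy; have [_ h1 h2] := SU_spec.
by apply: (lt_le_trans h2); apply: Cf_right; rewrite h1.
Qed.

(** Between [zn0] and [Cm] the cost does not exceed its value at [zn0], which is below every value
    from [SU] on. *)
Lemma Cf_zn0_right x y : zn0 M t <= x -> x <= y -> SU M t <= y -> Cf M t x <= Cf M t y.
Proof.
move=> zx xy Sy; have [xC|Cx] := leP x (Cm M t); last by apply: Cf_right; rewrite ltW.
have := Cf_after_SU Sy; have := adm_K adm tT.
have : Cf M t x <= Cf M t (zn0 M t) by apply: Cf_left; rewrite zx.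
lra.
Qed.

End Cost.

Definition lconst (g : R -> R) : Prop := exists A c, forall x, x < A -> g x = c.

Lemma evconst_shift g y : lconst g -> evconst (fun j => g (y - z j)).
Proof.
move=> [A [c gc]].
have [N HN] : exists N : nat, forall n, (N <= n)%N -> y - z n < A.
  have [m [m1 m2]] : exists2 m, isgrid M m & y - A < m by exact: grid_above.
  exists (absz m1).+1 => n Nn; suff : zg M m1 <= z n by rewrite -m2; lra.
  by rewrite zg_le //; lia.
by exists N => n Nn; rewrite !gc ?HN.
Qed.

(** Transfers a termwise linear inequality among up to four sequences and a constant to their sums;
    free slots get the coefficient 0. *)
Lemma gsum_lin_ge0 t u1 u2 u3 u4 a1 a2 a3 a4 d : (t < T)%N ->
  evconst u1 -> evconst u2 -> evconst u3 -> evconst u4 ->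
  (forall n, 0 <= a1 * u1 n + a2 * u2 n + a3 * u3 n + a4 * u4 n + d :> R) ->
  0 <= a1 * gsum M t u1 + a2 * gsum M t u2 + a3 * gsum M t u3 + a4 * gsum M t u4 + d.
Proof.
move=> tT e1 e2 e3 e4 h; have D0 := adm_demand adm tT.
have E1 := evconstZ a1 e1; have E2 := evconstD E1 (evconstZ a2 e2).
have E3 := evconstD E2 (evconstZ a3 e3); have E4 := evconstD E3 (evconstZ a4 e4).
have E5 := evconstD E4 (evconst_cst d).
have := gsum_le t th0 (evconst_cst 0) E5 h.
rewrite (gsumD t th0 E4 (evconst_cst d)) (gsumD t th0 E3 (evconstZ a4 e4)).
rewrite (gsumD t th0 E2 (evconstZ a3 e3)) (gsumD t th0 E1 (evconstZ a2 e2)).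
by rewrite !(gsumZ t th0) // !(gsum_cst th0 D0).
Qed.

Lemma Vt_lt t y : y < st M t -> Vt M t y = Ht M t (St M t) + K t.
Proof. by rewrite /Vt /Vof => ->. Qed.

Lemma Vt_ge t y : st M t <= y -> Vt M t y = Ht M t y.
Proof. by rewrite /Vt /Vof leNgt => /negbTE ->. Qed.

Lemma Vt_lconst t : lconst (Vt M t).
Proof. by exists (st M t), (Ht M t (St M t) + K t) => x; exact: Vt_lt. Qed.

Section Rec.
Context (t : nat) (tT : (t.+1 < T)%N).

Lemma stage_index : ((T.-1 - t)%N = (T.-1 - t.+1).+1) * (T - 2 - (T.-1 - t.+1) = t)%N.
Proof. by split; lia. Qed.

Lemma Ht_rec y : Ht M t y = Cf M t y + alpha * gsum M t (fun j => Vt M t.+1 (y - z j)).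
Proof. by rewrite /Ht stage_index /= stage_index. Qed.

Lemma It_rec : It M t =
  sup [set w | isgrid M w /\ w < Num.min (Ibar M t.+1 - theta) (Cm M t)].
Proof. by rewrite /It stage_index /= stage_index. Qed.

Lemma Ibar_rec : Ibar M t =
  sup [set w | isgrid M w /\ w <= It M t /\ Cf M t (It M t) + K t < Cf M t w] + theta.
Proof. by rewrite It_rec /Ibar stage_index /= stage_index. Qed.

Lemma St_rec : St M t =
  sup [set w | isgrid M w /\ It M t <= w <= SU M t /\
    forall w', isgrid M w' -> It M t <= w' <= SU M t -> Ht M t w <= Ht M t w'].
Proof. by rewrite /St /It /Ht stage_index /= stage_index. Qed.

Lemma st_rec : st M t = if K t == 0 then St M t
  else inf [set w | isgrid M w /\ Ibar M t <= w <= St M t /\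
    Ht M t w <= Ht M t (St M t) + K t].
Proof. by rewrite /st /St /Ibar /Ht stage_index /= stage_index. Qed.

End Rec.

(* In the last stage [s] and [S] need not be grid points, but there [H] is
   convex on the whole line. *)
Definition dom (t : nat) : set R := [set x | (T <= t.+1)%N \/ isgrid M x].

(** The invariant of the backward recursion. [so_hs] and [so_below] make [s_t] the ordering
    threshold; [so_SU] concerns the stages in which [S_t] is selected from the window [[It, SU]]. *)
Record stage_ok (t : nat) : Prop := StageOk {
  so_S : dom t (St M t);
  so_s : dom t (st M t);
  so_sS : st M t <= St M t;
  so_Ibar : Ibar M t <= st M t;
  so_min : forall x, dom t x -> Ht M t (St M t) <= Ht M t x;
  so_hs : Ht M t (st M t) <= Ht M t (St M t) + K t;
  so_below : forall x, dom t x -> x < st M t -> Ht M t (St M t) + K t <= Ht M t x;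
  so_kc : kconvex (dom t) (K t) (Ht M t);
  so_SU : (t.+1 < T)%N -> St M t <= SU M t
}.

Lemma dom_grid t x : isgrid M x -> dom t x. Proof. by right. Qed.

Lemma stage_ok_last : stage_ok T.-1.
Proof.
have T2 := adm_T adm; have tT : (T.-1 < T)%N by lia.
have Tn : (T <= T.-1.+1)%N by lia.
have [h1 h2] := inf_level (adm_gamma adm tT) (adm_lip adm tT) (adm_coer adm tT)
  (Cm_min tT) (adm_K adm tT).
have HE : Ht M T.-1 = Cf M T.-1 by rewrite /Ht subnn.
have SE : St M T.-1 = Cm M T.-1 by rewrite /St subnn.
have sE : st M T.-1 = sT1 M by rewrite /st subnn.
have IE : Ibar M T.-1 = sT1 M by rewrite /Ibar subnn.
split; rewrite ?HE ?SE ?sE ?IE //; do ?by left.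
- by move=> x _; exact: Cm_min.
- by rewrite [leLHS]h2.
- by move=> x _ xs; rewrite -h2; apply: (Cf_left tT); rewrite (ltW xs).
- move=> a b c _ _ _ ab bc.
  have := @convex_chord _ _ (adm_conv adm tT) a b c; have := adm_K adm tT; nra.
- by rewrite prednK ?ltnn //; lia.
Qed.

Lemma grid_argmin (h : R -> R) a b : isgrid M a -> isgrid M b -> a <= b ->
  exists w, [/\ isgrid M w, a <= w <= b &
    forall w', isgrid M w' -> a <= w' <= b -> h w <= h w'].
Proof.
move=> [m ->] [n ->]; rewrite zg_le // => mn.
have [k ->] : exists k : nat, n = m + k%:Z by exists (absz (n - m)); lia.
elim: k => [|k [w [gw mw Hw]]].
  exists (zg M m); split; [by exists m | by rewrite addr0 lexx | ].
  move=> w' _; rewrite addr0 => mw; suff -> : w' = zg M m by []; lra.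
pose b' := zg M (m + k.+1%:Z).
have bE : b' = zg M (m + k%:Z) + theta by rewrite -zgD1; congr zg; lia.
have gb : isgrid M b' by eexists.
have mb : zg M m <= b' by rewrite zg_le //; lia.
have split_b w' : isgrid M w' -> zg M m <= w' <= b' -> w' = b' \/ zg M m <= w' <= zg M (m + k%:Z).
  move=> gw' /andP[h1 h2]; have [bw|wb] := leP b' w'; first by left; lra.
  by right; rewrite h1 /=; have := grid_gap th0 gw' gb wb; lra.
have [hb|hb] := leP (h b') (h w).
  exists b'; split => //; first by rewrite lexx andbT.
  by move=> w' gw' /(split_b _ gw')[-> //|] /(Hw _ gw'); exact: le_trans.
exists w; split => //; first by move: mw; rewrite -/b' => /andP[-> h1] /=; have := th0; lra.
by move=> w' gw' /(split_b _ gw')[->|]; [exact: ltW | exact: Hw].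
Qed.

Lemma gridP t x : (t.+1 < T)%N -> dom t x -> isgrid M x.
Proof. by move=> tT [|//]; lia. Qed.

Lemma z_ge (j : nat) : - theta <= z j.
Proof. rewrite -[- theta]mulN1r -[-1]/((-1)%:~R) -/(zg M (-1)) zg_le //; lia. Qed.

(** * One backward step of the grid recursion *)

Section Step.
Context (t : nat) (tT : (t.+1 < T)%N) (ok : stage_ok t.+1).
Let tT' : (t < T)%N. Proof. by lia. Qed.

Lemma It_spec : [/\ isgrid M (It M t), It M t < Ibar M t.+1 - theta & It M t < Cm M t].
Proof.
pose W := [set w | isgrid M w /\ w < Num.min (Ibar M t.+1 - theta) (Cm M t)].
have [|||] := @grid_sup _ M th0 W.
- by move=> w [].
- by have [g gg gC] := grid_below th0 (Num.min (Ibar M t.+1 - theta) (Cm M t)); exists g.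
- by exists (Num.min (Ibar M t.+1 - theta) (Cm M t)) => w [_ /ltW].
by rewrite -(It_rec tT) => -[h1]; rewrite lt_min => /andP[h2 h3] _.
Qed.

(** The largest upward shift is [theta], from [z 0 = -theta], and [It] lies more than [theta] below
    [Ibar_(t+1)]. Every argument of [V_(t+1)] is thus below [s_(t+1)], where [V_(t+1)] is
    constant. *)
Lemma Ht_low x : x <= It M t ->
  Ht M t x = Cf M t x + alpha * (Ht M t.+1 (St M t.+1) + K t.+1).
Proof.
move=> xI; rewrite (Ht_rec tT); congr (_ + alpha * _).
rewrite -[RHS](gsum_cst th0 (adm_demand adm tT')); congr gsum; apply/funext => j.
apply: Vt_lt; have [_ h _] := It_spec; have := z_ge j; have := so_Ibar ok; lra.
Qed.

Lemma Ibar_spec : [/\ isgrid M (Ibar M t), Ibar M t <= It M t &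
  Cf M t (It M t) + K t < Cf M t (Ibar M t - theta)].
Proof.
have [gI IB IC] := It_spec.
pose W := [set w | isgrid M w /\ w <= It M t /\ Cf M t (It M t) + K t < Cf M t w].
have [|||[h1 [h2 h3]] _] := @grid_sup _ M th0 W.
- by move=> w [].
- have [B HB] := adm_coer adm tT' (Cf M t (It M t) + K t + 1).
  have [g gg] := grid_below th0 (Num.min (It M t) (- B)); rewrite lt_min => /andP[gI' gB].
  exists g; split => //; split; first exact: ltW.
  have := HB g; have := ler_norm (- g); rewrite normrN; lra.
- by exists (It M t) => w [_ []].
rewrite (Ibar_rec tT) -/W addrK; split => //; first exact: gridD1.
apply: grid_gap => //; rewrite lt_neqAle h2 andbT; apply/eqP => e.
by move: h3; rewrite e; have := adm_K adm tT'; lra.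
Qed.

Lemma It_SU : It M t <= SU M t.
Proof. by have [_ _ h] := It_spec; have [_ h' _] := SU_spec tT'; lra. Qed.

Lemma St_spec : [/\ isgrid M (St M t), It M t <= St M t <= SU M t &
    forall w', isgrid M w' -> It M t <= w' <= SU M t -> Ht M t (St M t) <= Ht M t w'].
Proof.
have [gI _ _] := It_spec; have [gS _ _] := SU_spec tT'.
pose W := [set w | isgrid M w /\ It M t <= w <= SU M t /\
    forall w', isgrid M w' -> It M t <= w' <= SU M t -> Ht M t w <= Ht M t w'].
have [|||[h1 [h2 h3]] _] := @grid_sup _ M th0 W.
- by move=> w [].
- by have [w [gw wI wm]] := grid_argmin (Ht M t) gI gS It_SU; exists w.
- by exists (SU M t) => w [_ [/andP[]]].
by rewrite (St_rec tT).
Qed.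

Lemma Vt1_le_add a b : isgrid M a -> isgrid M b -> a <= b ->
  Vt M t.+1 a <= Vt M t.+1 b + K t.+1.
Proof.
move=> ga gb ab; apply: (@Vof_le_add _ (dom t.+1)) => //; try exact: dom_grid.
- exact: adm_K.
- exact: so_S.
- exact: so_s.
- exact: so_min.
- exact: so_hs.
- exact: so_kc.
Qed.

(** The loss of more than [K_t] in [C_t] outweighs [alpha K_(t+1) <= K_t], the most by which the
    future cost can favour the higher stock. *)
Lemma Ht_after_SU y : isgrid M y -> SU M t <= y -> Ht M t (zn0 M t) <= Ht M t y.
Proof.
move=> gy Sy; have [gz _ _] := zn0_spec t; have zS := zn0_SU tT'.
have h := Cf_after_SU tT' Sy.
have KK : alpha * K t.+1 <= K t by exact: adm_KK.
rewrite !(Ht_rec tT).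
have e1 := evconst_shift (zn0 M t) (Vt_lconst t.+1).
have e2 := evconst_shift y (Vt_lconst t.+1).
have h' n : Vt M t.+1 (zn0 M t - z n) <= Vt M t.+1 (y - z n) + K t.+1.
  by apply: Vt1_le_add; [exact: gridBz|exact: gridBz|lra].
have := gsum_lin_ge0 (a1 := -1) (a2 := 1) (a3 := 0) (a4 := 0) (d := K t.+1) tT' e1 e2 e2 e2
  (fun n => ltac:(have := h' n; lra)).
by have := alpha_ge0; nra.
Qed.

(** Nothing is lost outside the window: below [It], [H_t] is [C_t] plus a constant and [C_t] is
    nonincreasing; beyond [SU], the point [zn0] is no worse, and it is in the window because it is
    the largest grid point below [Cm]. *)
Lemma Ht_min x : isgrid M x -> Ht M t (St M t) <= Ht M t x.
Proof.
move=> gx; have [gS IS Smin] := St_spec; have [gI IB IC] := It_spec.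
have [xI|Ix] := ltP x (It M t).
  apply: (le_trans (Smin _ gI _)); first by rewrite lexx It_SU.
  rewrite (Ht_low (lexx _)) (Ht_low (ltW xI)) lerD2r; apply: (Cf_left tT'); lra.
have [xS|Sx] := leP x (SU M t); first by apply: Smin => //; rewrite Ix.
have [gz zC zm] := zn0_spec t.
apply: (le_trans (Smin _ gz _)); last exact: (Ht_after_SU gx (ltW Sx)).
by rewrite (ltW (zn0_SU tT')) andbT; apply: zm.
Qed.

(** Shifts by [z n] keep grid points on the grid, so [V_(t+1)] contributes K-convexity term by term;
    the discounted constant is [alpha K_(t+1) <= K_t]. *)
Lemma Ht_kconvex : kconvex (isgrid M) (K t) (Ht M t).
Proof.
move=> a b c ga gb gc ab bc.
have KK : alpha * K t.+1 <= K t by exact: adm_KK.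
rewrite !(Ht_rec tT).
have ea := evconst_shift a (Vt_lconst t.+1).
have eb := evconst_shift b (Vt_lconst t.+1).
have ec := evconst_shift c (Vt_lconst t.+1).
have hC := @convex_chord _ _ (adm_conv adm tT') a b c.
have kc : kconvex (dom t.+1) (K t.+1) (Vt M t.+1).
  apply: kconvex_Vof.
  - exact: adm_K.
  - exact: so_S.
  - exact: so_s.
  - exact: so_sS.
  - exact: so_min.
  - exact: so_hs.
  - exact: so_kc.
have h' n : (c - b) * (Vt M t.+1 (b - z n) - Vt M t.+1 (a - z n)) <=
    (b - a) * (K t.+1 + Vt M t.+1 (c - z n) - Vt M t.+1 (b - z n)).
  have gz x : isgrid M x -> dom t.+1 (x - z n) by move=> gx; apply: dom_grid; exact: gridBz.
  have := kc _ _ _ (gz _ ga) (gz _ gb) (gz _ gc); rewrite ltrD2r lerD2r => /(_ ab bc).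
  by rewrite !opprB !addrA !subrK.
have := gsum_lin_ge0 (a1 := c - b) (a2 := a - c) (a3 := b - a) (a4 := 0) (d := (b - a) * K t.+1)
  tT' ea eb ec ea (fun n => ltac:(have := h' n; lra)).
move=> h; have {}h := mulr_ge0 alpha_ge0 h.
have {}hC : (c - a) * Cf M t b <= (c - b) * Cf M t a + (b - a) * Cf M t c by apply: hC; lra.
have hK : (b - a) * (alpha * K t.+1) <= (b - a) * K t by rewrite ler_wpM2l //; lra.
lra.
Qed.

(** Left of [Ibar] the cost [C_t] exceeds [C_t(It) + K_t] while [H_t - C_t] is constant, so the
    search for [s_t] may start at [Ibar]. *)
Lemma Ht_before_Ibar x : isgrid M x -> x < Ibar M t -> Ht M t (St M t) + K t <= Ht M t x.
Proof.
move=> gx xI; have [gb bI hb] := Ibar_spec; have [gI IB IC] := It_spec.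
have xb : x <= Ibar M t - theta by have := grid_gap th0 gx gb xI; lra.
have hI := Ht_min gI; have th := th0.
rewrite (Ht_low (x := x)); last by lra.
rewrite (Ht_low (x := It M t)) // in hI.
have : Cf M t (Ibar M t - theta) <= Cf M t x by apply: (Cf_left tT'); lra.
lra.
Qed.

Lemma stage_ok_step : stage_ok t.
Proof.
have [gS IS Smin] := St_spec; have [gI IB IC] := It_spec; have [gb bI hb] := Ibar_spec.
have K0 := adm_K adm tT'.
have [gs [sS bs] [hs hbelow]] : [/\ isgrid M (st M t), st M t <= St M t /\ Ibar M t <= st M t &
   Ht M t (st M t) <= Ht M t (St M t) + K t /\
   forall x, isgrid M x -> x < st M t -> Ht M t (St M t) + K t <= Ht M t x].
  rewrite (st_rec tT); case: eqP => [k0|_].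
    rewrite k0 !addr0; split => //; split => //; first by lra.
    by move=> x gx _; exact: Ht_min.
  pose W := [set w | isgrid M w /\ Ibar M t <= w <= St M t /\
    Ht M t w <= Ht M t (St M t) + K t].
  have [|||[h1 [h2 h3]] h4] := @grid_inf _ M th0 W.
  - by move=> w [].
  - exists (St M t); split => //; split; last by rewrite lerDl.
    by rewrite lexx andbT; lra.
  - by exists (Ibar M t) => w [_ [/andP[]]].
  rewrite -/W; split => //; first by split; lra.
  split => // x gx xW; have [xI|Ix] := ltP x (Ibar M t); first exact: Ht_before_Ibar.
  rewrite leNgt; apply/negP => hx.
  suff : inf W <= x by lra.
  by apply: h4; split => //; split; [lra | exact: ltW].
split => //; try exact: dom_grid.
- by move=> x /(gridP tT); exact: Ht_min.
- by move=> x /(gridP tT); exact: hbelow.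
- by move=> a b c /(gridP tT) ga /(gridP tT) gb' /(gridP tT) gc; exact: Ht_kconvex.
- by move=> _; lra.
Qed.

End Step.

Lemma stages_ok t : (t < T)%N -> stage_ok t.
Proof. move: t; apply: back_ind; [exact: stage_ok_last | exact: stage_ok_step]. Qed.

End Stages.

(** * The estimate functions *)

Section Estimates.
Context {R : realType} (M : model R) (adm : admissible M).
Local Notation T := (mT M).
Local Notation alpha := (malpha M).
Local Notation K := (mK M).
Local Notation theta := (mtheta M).
Local Notation gamma := (mgamma M).
Local Notation z j := (zg M (j%:Z - 1)).
Local Notation isgrid := (isgrid M).
Local Notation S := (St M).
Local Notation s := (st M).
Local Notation H := (Ht M).
Local Notation V := (Vt M).

Let th0 : 0 < theta := adm_theta adm.
Let a0 : 0 <= alpha := alpha_ge0 adm.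

(* [d = 0] gives (psi, phi) and [d = theta] gives (psibar, phibar). *)
Definition psid (d : R) (t : nat) : R -> R -> R := (psiphi M d (T.-1 - t)).1.
Definition phid (d : R) (t : nat) : R -> R -> R := (psiphi M d (T.-1 - t)).2.

Lemma psid_last d x y : psid d T.-1 x y = gamma T.-1 * x.
Proof. by rewrite /psid subnn. Qed.

Lemma phid_last d x y : phid d T.-1 x y = if y < s T.-1 then 0 else gamma T.-1 * x.
Proof. by rewrite /phid subnn. Qed.

Lemma phid_rec d t x y : (t.+1 < T)%N -> phid d t x y =
  if y < s t then 0
  else if y - x < s t then psid d t (y - s t + d) y else psid d t x y.
Proof. by move=> tT; rewrite /psid /phid (stage_index adm tT) /= (stage_index adm tT). Qed.

Lemma phid_lt d t x y : (t < T)%N -> y < s t -> phid d t x y = 0.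
Proof.
move=> tT ys; have [tT1|Tt] := ltnP t.+1 T; first by rewrite phid_rec // ys.
by rewrite (_ : t = T.-1) ?phid_last; [rewrite (_ : T.-1 = t) ?ys //|]; lia.
Qed.

Lemma phid_lconst d t x : (t < T)%N -> lconst (phid d t x).
Proof. by move=> tT; exists (s t), 0 => y; exact: phid_lt. Qed.

(** The case distinction and the truncation in the definition only drop zero terms, as [phi]
    vanishes below [s_(t+1)]. With [n = floor + 2] terms the first omitted shift is
    [z n > y - s_(t+1)]. *)
Lemma psid_rec d t x y : (t.+1 < T)%N ->
  psid d t x y = gamma t * x + alpha * gsum M t (fun j => phid d t.+1 x (y - z j)).
Proof.
move=> tT; have tT' : (t < T)%N by lia.
have D0 := adm_demand adm tT'.
rewrite /psid (stage_index adm tT) /= (stage_index adm tT) -/(phid d t.+1 x).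
case: ifPn => [ys|].
  rewrite (_ : (fun j => _) = fun=> 0) ?(gsum_cst th0 D0) ?mulr0 ?addr0 //.
  apply/funext => j; apply: phid_lt => //; have := z_ge adm j; lra.
rewrite -leNgt => sy; congr (_ + _ * _); set fl := Num.floor _.
have /andP[_ fl2] : fl%:~R <= (y - s t.+1) / theta < (fl + 1)%:~R by exact: floor_itv.
have fl0 : -1 <= fl.
  by rewrite /fl floor_ge_int ler_pdivlMr // mulN1r; lra.
rewrite [RHS](@gsum_split _ _ _ th0 _ (absz (fl + 2)) 0); first by rewrite mul0r addr0.
move=> n Nn; apply: phid_lt => //.
suff : y - s t.+1 < z n by lra.
rewrite /zg -ltr_pdivrMr //; apply: (lt_le_trans fl2); rewrite ler_int; lia.
Qed.

(** For [d = 0] the last two branches merge, which exposes monotonicity in both arguments. *)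
Lemma phid0_min t x y : (t.+1 < T)%N -> phid 0 t x y =
  if y < s t then 0 else psid 0 t (Num.min x (y - s t)) y.
Proof.
move=> tT; rewrite phid_rec //; case: ifP => // _; rewrite addr0.
case: ifPn => [h|]; first by rewrite min_r //; lra.
by rewrite -leNgt => h; rewrite min_l //; lra.
Qed.

(** * Monotonicity of the estimates and bounds on increments *)

Lemma psid0_mono_rec t : (t.+1 < T)%N ->
  (forall x x' y y', 0 <= x <= x' -> y <= y' ->
    0 <= phid 0 t.+1 x y <= phid 0 t.+1 x' y') ->
  forall x x' y y', 0 <= x <= x' -> y <= y' ->
    gamma t * x <= psid 0 t x y /\ psid 0 t x y <= psid 0 t x' y'.
Proof.
move=> tT IH x x' y y' xx yy; have tT' : (t < T)%N by lia.
rewrite !psid_rec //.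
have e1 := evconst_shift adm y (phid_lconst 0 x tT).
have e2 := evconst_shift adm y' (phid_lconst 0 x' tT).
have hn n : 0 <= phid 0 t.+1 x (y - z n) <= phid 0 t.+1 x' (y' - z n).
  by apply: IH => //; lra.
have h1 := gsum_lin_ge0 adm (a1 := 1) (a2 := 0) (a3 := 0) (a4 := 0) (d := 0) tT' e1 e1 e1 e1
  (fun n => ltac:(have := hn n; lra)).
have h2 := gsum_lin_ge0 adm (a1 := -1) (a2 := 1) (a3 := 0) (a4 := 0) (d := 0) tT' e1 e2 e1 e1
  (fun n => ltac:(have := hn n; lra)).
have g0 := adm_gamma adm tT'; have aa := a0.
by split; nra.
Qed.

Lemma phid0_mono t x x' y y' : (t < T)%N -> 0 <= x <= x' -> y <= y' ->
  0 <= phid 0 t x y <= phid 0 t x' y'.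
Proof.
move=> tT; move: t tT x x' y y'; apply: (back_ind adm).
  move=> x x' y y' xx yy; rewrite !phid_last.
  have T2 := adm_T adm; have := @adm_gamma _ _ adm T.-1 ltac:(lia) => g0.
  case: ltP => hy; case: ltP => hy'; try lra; try nra.
move=> t tT IH x x' y y' xx yy; have mono := psid0_mono_rec tT IH.
have g0 : 0 <= gamma t by apply: (adm_gamma adm); lia.
rewrite !phid0_min //; case: ltP => hy; case: ltP => hy'; rewrite ?lexx //=; try lra.
  have m0 : 0 <= Num.min x' (y' - s t) <= Num.min x' (y' - s t).
    by rewrite lexx andbT le_min; lra.
  have [h _] := mono _ _ _ _ m0 (lexx y'); apply: le_trans h; apply: mulr_ge0 => //; lra.
have m0 : 0 <= Num.min x (y - s t) <= Num.min x' (y' - s t).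
  rewrite le_min; apply/andP; split; first lra.
  by rewrite le_min !ge_min; apply/andP; split; apply/orP; [left|right]; lra.
have [h ->] := mono _ _ _ _ m0 yy; rewrite andbT; apply: le_trans h; apply: mulr_ge0 => //; lra.
Qed.

Lemma psid0_mono t x x' y y' : (t.+1 < T)%N -> 0 <= x <= x' -> y <= y' ->
  psid 0 t x y <= psid 0 t x' y'.
Proof.
move=> tT xx yy; apply: (psid0_mono_rec tT _ xx yy).2 => *; exact: phid0_mono.
Qed.

Lemma Ht_incr_le_rec t : (t.+1 < T)%N ->
  (forall x y, 0 <= x -> V t.+1 y - V t.+1 (y - x) <= phid 0 t.+1 x y) ->
  forall x y, 0 <= x -> H t y - H t (y - x) <= psid 0 t x y.
Proof.
move=> tT IH x y x0; have tT' : (t < T)%N by lia.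
rewrite psid_rec // !(Ht_rec adm tT).
have e1 := evconst_shift adm y (Vt_lconst M t.+1).
have e2 := evconst_shift adm (y - x) (Vt_lconst M t.+1).
have e3 := evconst_shift adm y (phid_lconst 0 x tT).
have hn n : V t.+1 (y - z n) - V t.+1 (y - x - z n) <= phid 0 t.+1 x (y - z n).
  by have := IH x (y - z n) x0; rewrite (_ : y - z n - x = y - x - z n) //; ring.
have h1 := gsum_lin_ge0 adm (a1 := -1) (a2 := 1) (a3 := 1) (a4 := 0) (d := 0) tT' e1 e2 e3 e1
  (fun n => ltac:(have := hn n; lra)).
have := adm_lip adm tT' y (y - x); rewrite (_ : y - (y - x) = x) ?(ger0_norm x0); last ring.
by rewrite ler_norml => /andP[_ hC]; have {}h1 := mulr_ge0 a0 h1; lra.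
Qed.

(** If [y - x < s_t <= y], then [V_t(y - x) = H_t(S_t) + K_t >= H_t(s_t)], so only the rise of [H_t]
    from [s_t] to [y] counts; hence the branch of [phi] with argument [y - s_t]. *)
Lemma Vt_incr_le t x y : (t < T)%N -> 0 <= x -> V t y - V t (y - x) <= phid 0 t x y.
Proof.
move=> tT; move: t tT x y; apply: (back_ind adm).
  move=> x y x0; have T2 := adm_T adm; have tT : (T.-1 < T)%N by lia.
  have ok := stages_ok adm tT; have g0 := adm_gamma adm tT.
  rewrite phid_last; case: ltP => ys.
    by rewrite !Vt_lt ?subrr //; lra.
  have HE : H T.-1 = Cf M T.-1 by rewrite /Ht subnn.
  rewrite (Vt_ge ys); have [h|h] := ltP (y - x) (s T.-1).
    rewrite (Vt_lt h); have := so_hs ok; rewrite HE => hs.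
    have := @lip_le _ _ _ g0 (adm_lip adm tT) y (s T.-1) (y - s T.-1).
    rewrite ger0_norm ?subr_ge0 // lexx => /(_ isT) hl.
    have : gamma T.-1 * (y - s T.-1) <= gamma T.-1 * x by rewrite ler_wpM2l //; lra.
    lra.
  rewrite (Vt_ge h) HE.
  have := @lip_le _ _ _ g0 (adm_lip adm tT) y (y - x) x.
  rewrite (_ : y - (y - x) = x) ?(ger0_norm x0) ?lexx; last ring.
  by move=> /(_ isT); lra.
move=> t tT IH x y x0; have ok := stages_ok adm (ltnW tT); rewrite phid_rec //.
case: ltP => ys; first by rewrite !Vt_lt ?subrr //; lra.
rewrite (Vt_ge ys) addr0; case: ltP => h.
  rewrite (Vt_lt h); have := so_hs ok.
  have := @Ht_incr_le_rec t tT IH (y - s t) y; rewrite subr_ge0 => /(_ ys).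
  by rewrite (_ : y - (y - s t) = s t); [lra | ring].
by rewrite (Vt_ge h); exact: Ht_incr_le_rec.
Qed.

Lemma Ht_last_level : H T.-1 (s T.-1) = H T.-1 (S T.-1) + K T.-1.
Proof.
have T2 := adm_T adm; have tT : (T.-1 < T)%N by lia.
rewrite /Ht /St /st subnn /=.
by have [_] := inf_level (adm_gamma adm tT) (adm_lip adm tT) (adm_coer adm tT)
  (Cm_min adm tT) (adm_K adm tT).
Qed.

(** Since [s_(T-1)] hits its level exactly, [V_(T-1)(u)] is [C_(T-1)] at [max(u, s_(T-1))], and this
    truncation does not increase distances. *)
Lemma Vt_last_lip x y d : `|x - y| <= d -> V T.-1 x <= V T.-1 y + gamma T.-1 * d.
Proof.
have T2 := adm_T adm; have tT : (T.-1 < T)%N by lia.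
have HE : H T.-1 = Cf M T.-1 by rewrite /Ht subnn.
have VE u : V T.-1 u = Cf M T.-1 (Num.max u (s T.-1)).
  by rewrite /Vt /Vof -Ht_last_level HE; case: ltP.
move=> xy; rewrite !VE; apply: (lip_le (adm_gamma adm tT) (adm_lip adm tT)).
apply: le_trans xy; rewrite ler_norml; have := ler_norm (x - y).
have := ler_norm (y - x); rewrite distrC => h1 h2.
by case: (leP x (s T.-1)) => hx; case: (leP y (s T.-1)) => hy;
  apply/andP; split; have := normr_ge0 (x - y); lra.
Qed.

(** On the grid the middle branch of [phibar] occurs only at [g = s_t], where its argument
    [g - s_t + theta] equals [theta]. *)
Lemma phidth_grid t g : (t < T)%N -> isgrid g ->
  phid theta t theta g = if g < s t then 0 else psid theta t theta g.
Proof.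
move=> tT gg; have [tT1|Tt] := ltnP t.+1 T; last first.
  by rewrite (_ : t = T.-1) ?phid_last ?psid_last //; lia.
have gs : isgrid (s t) by apply: (gridP adm tT1); exact: so_s (stages_ok adm tT).
rewrite phid_rec //; case: ltP => // sg; case: ltP => // gs'.
suff -> : g = s t by rewrite subrr add0r.
by apply/eqP; rewrite eq_le sg andbT leNgt; apply/negP => /(grid_gap th0 gs gg); lra.
Qed.

(* Unlike [psi], [psibar theta] is monotone only along the grid: off the grid
   [phibar t theta y] can drop as [y] passes [s t + theta]. *)
Lemma psidth_mono_rec t : (t.+1 < T)%N ->
  (forall g g', isgrid g -> isgrid g' -> g <= g' ->
    0 <= phid theta t.+1 theta g <= phid theta t.+1 theta g') ->
  forall g g', isgrid g -> isgrid g' -> g <= g' ->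
    gamma t * theta <= psid theta t theta g /\ psid theta t theta g <= psid theta t theta g'.
Proof.
move=> tT IH g g' gg gg' le_g; have tT' : (t < T)%N by lia.
rewrite !psid_rec //.
have e1 := evconst_shift adm g (phid_lconst theta theta tT).
have e2 := evconst_shift adm g' (phid_lconst theta theta tT).
have hn n : 0 <= phid theta t.+1 theta (g - z n) <= phid theta t.+1 theta (g' - z n).
  by apply: IH; [exact: gridBz | exact: gridBz | lra].
have h1 := gsum_lin_ge0 adm (a1 := 1) (a2 := 0) (a3 := 0) (a4 := 0) (d := 0) tT' e1 e1 e1 e1
  (fun n => ltac:(have := hn n; lra)).
have h2 := gsum_lin_ge0 adm (a1 := -1) (a2 := 1) (a3 := 0) (a4 := 0) (d := 0) tT' e1 e2 e1 e1
  (fun n => ltac:(have := hn n; lra)).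
have {}h1 := mulr_ge0 a0 h1; have {}h2 := mulr_ge0 a0 h2.
by split; lra.
Qed.

Lemma phidth_mono t g g' : (t < T)%N -> isgrid g -> isgrid g' -> g <= g' ->
  0 <= phid theta t theta g <= phid theta t theta g'.
Proof.
move=> tT; move: t tT g g'; apply: (back_ind adm).
  move=> g g' _ _ gg'; rewrite !phid_last.
  have T2 := adm_T adm; have := @adm_gamma _ _ adm T.-1 ltac:(lia) => g0.
  have gt0 := mulr_ge0 g0 (ltW th0).
  by case: ltP => hy; case: ltP => hy'; lra.
move=> t tT IH g g' gg gg' le_g; have mono := psidth_mono_rec tT IH.
have g0 : 0 <= gamma t by apply: (adm_gamma adm); lia.
have gt0 := mulr_ge0 g0 (ltW th0).
have [h1 h2] := mono _ _ gg gg' le_g.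
rewrite !phidth_grid //; try lia.
by case: ltP => hy; case: ltP => hy'; lra.
Qed.

Lemma psidth_mono t g g' : (t.+1 < T)%N -> isgrid g -> isgrid g' -> g <= g' ->
  psid theta t theta g <= psid theta t theta g'.
Proof.
move=> tT gg gg' le_g; apply: (psidth_mono_rec tT _ gg gg' le_g).2 => *; exact: phidth_mono.
Qed.

Lemma psidth_ge0 t g : (t.+1 < T)%N -> isgrid g -> 0 <= psid theta t theta g.
Proof.
move=> tT gg.
have [|h _] := psidth_mono_rec tT _ gg gg (lexx g); first by move=> *; exact: phidth_mono.
by apply: le_trans h; apply: mulr_ge0; [apply: (adm_gamma adm); lia | exact: ltW].
Qed.

(** * Oscillation over grid cells *)

Definition cell (g x : R) := g - theta <= x <= g.

Lemma Ht_osc_rec t : (t.+1 < T)%N ->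
  (forall g x y, isgrid g -> cell g x -> cell g y ->
    V t.+1 x - V t.+1 y <= phid theta t.+1 theta g) ->
  forall g x y, isgrid g -> cell g x -> cell g y -> H t x - H t y <= psid theta t theta g.
Proof.
move=> tT IH g x y gg gx gy; have tT' : (t < T)%N by lia.
rewrite psid_rec // !(Ht_rec adm tT).
have e1 := evconst_shift adm x (Vt_lconst M t.+1).
have e2 := evconst_shift adm y (Vt_lconst M t.+1).
have e3 := evconst_shift adm g (phid_lconst theta theta tT).
have hn n : V t.+1 (x - z n) - V t.+1 (y - z n) <= phid theta t.+1 theta (g - z n).
  by move: gx gy; rewrite /cell => gx gy; apply: IH; [exact: gridBz | rewrite /cell; lra..].
have h1 := gsum_lin_ge0 adm (a1 := -1) (a2 := 1) (a3 := 1) (a4 := 0) (d := 0) tT' e1 e2 e3 e1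
  (fun n => ltac:(have := hn n; lra)).
have := @lip_le _ _ _ (adm_gamma adm tT') (adm_lip adm tT') x y theta.
have -> : `|x - y| <= theta by rewrite ler_norml; move: gx gy; rewrite /cell; lra.
by move=> /(_ isT) hC; have {}h1 := mulr_ge0 a0 h1; lra.
Qed.

Lemma Vt_osc t g x y : (t < T)%N -> isgrid g -> cell g x -> cell g y ->
  V t x - V t y <= phid theta t theta g.
Proof.
move=> tT; move: t tT g x y; apply: (back_ind adm).
  move=> g x y gg gx gy; rewrite phid_last; case: ltP => gs.
    by move: gx gy; rewrite /cell => gx gy; rewrite !Vt_lt ?subrr //; lra.
  rewrite lerBlDl; apply: Vt_last_lip; rewrite ler_norml; move: gx gy; rewrite /cell; lra.
move=> t tT IH g x y gg gx gy; have tT' := ltnW tT; have ok := stages_ok adm tT'.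
have gs : isgrid (s t) by apply: (gridP adm tT); exact: so_s ok.
have th := th0.
have osc := Ht_osc_rec tT IH gg.
rewrite phidth_grid //; case: ltP => sg.
  by move: gx gy; rewrite /cell => gx gy; rewrite !Vt_lt ?subrr //; lra.
have [lt_sg|le_gs] := ltP (s t) g.
  have := grid_gap th0 gs gg lt_sg => gap.
  move: (gx) (gy); rewrite /cell => gx' gy'.
  by rewrite !Vt_ge; [exact: osc | lra..].
have e : g = s t by apply/eqP; rewrite eq_le le_gs.
have hs := so_hs ok.
(* The cell ending at [s_t] contains the jump of [V_t]. The constant value on its left is at most
   [H_t(s_t - theta)], so the oscillation of [H_t] over the cell covers it. *)
have hb : H t (S t) + K t <= H t (s t - theta).
  by apply: (so_below ok); [apply: dom_grid; exact: gridB1 | lra].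
have h1 := osc (s t - theta) (s t); have p0 := psidth_ge0 tT gg.
have {}h1 : H t (s t - theta) - H t (s t) <= psid theta t theta g.
  by apply: h1; rewrite /cell e; lra.
move: gx gy; rewrite /cell => gx gy.
have [xs|sx] := ltP x (s t); have [ys|sy] := ltP y (s t).
- by rewrite !Vt_lt ?subrr.
- by rewrite (Vt_lt xs) (Vt_ge sy) (_ : y = s t); lra.
- by rewrite (Vt_ge sx) (Vt_lt ys) (_ : x = s t); lra.
- by rewrite (_ : x = s t) 1?(_ : y = s t) ?subrr //; lra.
Qed.

Lemma Ht_osc t g x y : (t.+1 < T)%N -> isgrid g -> cell g x -> cell g y ->
  H t x - H t y <= psid theta t theta g.
Proof. by move=> tT; apply: Ht_osc_rec => // *; exact: Vt_osc. Qed.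

Lemma Vt_osc2 t g x y : (t < T)%N -> isgrid g ->
  g - theta - theta <= x <= g -> cell g y ->
  V t x - V t y <= 2 * phid theta t theta g.
Proof.
move=> tT gg gx gy; have th := th0; have gg1 := gridB1 gg.
have := phidth_mono tT gg1 gg ltac:(lra) => pm.
have [h|h] := leP (g - theta) x.
  by have := @Vt_osc t g x y tT gg; rewrite /cell in gy *; move=> /(_ ltac:(lra) gy); lra.
have := @Vt_osc t (g - theta) x (g - theta) tT gg1 ltac:(rewrite /cell; lra) ltac:(rewrite /cell; lra).
have := @Vt_osc t g (g - theta) y tT gg ltac:(rewrite /cell; lra) gy.
lra.
Qed.

(** The reference point is the common end of the two cells, so one [phibar] suffices where [Vt_osc2]
    needs two. *)
Lemma Vt_osc_left t g x : (t < T)%N -> isgrid g -> g - theta - theta <= x <= g ->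
  V t (g - theta) - V t x <= phid theta t theta g.
Proof.
move=> tT gg gx; have th := th0; have gg1 := gridB1 gg.
have := phidth_mono tT gg1 gg ltac:(lra) => pm.
have [h|h] := leP (g - theta) x.
  by apply: Vt_osc => //; rewrite /cell; lra.
have := @Vt_osc t (g - theta) (g - theta) x tT gg1 ltac:(rewrite /cell; lra) ltac:(rewrite /cell; lra).
lra.
Qed.

End Estimates.

(** * Optimal costs and the two bounds *)

Section OptimalCost.
Context {R : realType} (M : model R) (adm : admissible M).
Local Notation T := (mT M).
Local Notation alpha := (malpha M).
Local Notation c := (mc M).
Local Notation K := (mK M).
Local Notation theta := (mtheta M).
Local Notation gamma := (mgamma M).
Local Notation z j := (zg M (j%:Z - 1)).
Local Notation isgrid := (isgrid M).
Local Notation S := (St M).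
Local Notation s := (st M).
Local Notation H := (Ht M).
Local Notation V := (Vt M).
Local Notation C := (Cf M).
Local Notation psid := (psid M).
Local Notation phid := (phid M).

Let th0 : 0 < theta := adm_theta adm.
Let a0 : 0 <= alpha := alpha_ge0 adm.

(** * The optimality equation without linear ordering cost *)

Lemma v_last x : v M T x = - c T * x.
Proof. by rewrite /v subnn. Qed.

Lemma v_rec t x : (t < T)%N -> v M t x = inf [set r | exists2 y, x <= y &
  r = K t * delta (y - x) + c t * (y - x) + mG M t y
      + alpha * Ex M t (fun d => v M t.+1 (y - d))].
Proof.
move=> tT; rewrite /v (_ : T - t = (T - t.+1).+1)%N /=; last by lia.
by rewrite (_ : (T - (T - t.+1).+1 = t)%N) //; lia.
Qed.

Definition w (t : nat) (x : R) : R := v M t x + c t * x.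
Definition J (t : nat) (y : R) : R := C t y + alpha * Ex M t (fun d => w t.+1 (y - d)).

Lemma w_last x : w T x = 0.
Proof. by rewrite /w v_last mulNr addNr. Qed.

Section OneStage.
Context (t : nat) (tT : (t < T)%N).
Local Notation integrable h := ((mmu M t).-integrable setT (EFin \o h)).

Lemma cst_int (k : R) : integrable (fun=> k).
Proof. exact: finite_measure_integrable_cst. Qed.

Lemma Ex_cst (k : R) : Ex M t (fun=> k) = k.
Proof.
have := @Rintegral_cst _ _ R (mmu M t) setT measurableT k.
by rewrite /Rintegral /= /Ex => ->; rewrite probability_setT mulr1.
Qed.

Lemma ExD g h : integrable g -> integrable h ->
  Ex M t (fun d => g d + h d) = Ex M t g + Ex M t h.
Proof. by move=> ig ih; exact: (RintegralD measurableT ig ih). Qed.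

Lemma ExZ k g : integrable g -> Ex M t (fun d => k * g d) = k * Ex M t g.
Proof. by move=> ig; exact: (RintegralZl k measurableT ig). Qed.

Lemma intD g h : integrable g -> integrable h -> integrable (fun d => g d + h d).
Proof. by move=> ig ih; have := integrableD measurableT ig ih. Qed.

Lemma intZ k g : integrable g -> integrable (fun d => k * g d).
Proof. by move=> ig; have := integrableZl measurableT k ig. Qed.

Lemma w_shift y : (fun d => w t.+1 (y - d)) =
  (fun d => v M t.+1 (y - d) + (c t.+1 * y + - c t.+1 * d)).
Proof. by apply/funext => d; rewrite /w; ring. Qed.

Lemma w_int y : integrable (fun d => w t.+1 (y - d)).
Proof.
rewrite w_shift; apply: intD; first exact: (adm_int adm).
by apply: intD; [exact: cst_int | apply: intZ; exact: (adm_mean adm)].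
Qed.

Lemma Ex_w y : Ex M t (fun d => w t.+1 (y - d)) =
  Ex M t (fun d => v M t.+1 (y - d)) + (c t.+1 * y - c t.+1 * Ex M t id).
Proof.
have im := adm_mean adm tT; have iv := adm_int adm y tT.
have iZ := intZ (- c t.+1) im.
rewrite w_shift (ExD iv (intD (cst_int _) iZ)) (ExD (cst_int _) iZ).
by rewrite Ex_cst (ExZ _ im) mulNr.
Qed.

Lemma w_inf x : w t x = inf [set r | exists2 y, x <= y &
  r = K t * delta (y - x) + J t y - c t * x] + c t * x.
Proof.
rewrite /w v_rec //; congr (inf _ + _); apply/seteqP.
by split=> r [y xy ->]; exists y => //; rewrite /J Ex_w /Cf; ring.
Qed.

Lemma w_ge x r : (forall y, x <= y -> r <= K t * delta (y - x) + J t y) -> r <= w t x.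
Proof.
move=> h; rewrite w_inf -lerBlDr; apply: lb_le_inf.
  by exists (K t * delta (x - x) + J t x - c t * x), x.
by move=> _ [y xy ->]; rewrite lerD2r; exact: h.
Qed.

Lemma delta_ge0 (x : R) : 0 <= delta x. Proof. by rewrite /delta; case: ifP. Qed.
Lemma delta_le1 (x : R) : delta x <= 1. Proof. by rewrite /delta; case: ifP. Qed.

Lemma w_ge_cases x r : r <= J t x -> (forall y, x < y -> r <= K t + J t y) -> r <= w t x.
Proof.
move=> h0 h1; apply: w_ge => y; rewrite le_eqVlt => /predU1P[<-|xy].
  by rewrite subrr /delta ltxx mulr0 add0r.
by rewrite /delta subr_gt0 xy mulr1; exact: h1.
Qed.

End OneStage.

(** Serves [w_le]: membership bounds an infimum from above only when the set is bounded below. *)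
Lemma J_lbound t : (t < T)%N -> exists B, forall y, B <= J t y.
Proof.
move: t; apply: (back_ind adm).
  have T2 := adm_T adm; have tT : (T.-1 < T)%N by lia.
  exists (C T.-1 (Cm M T.-1)) => y; rewrite /J.
  rewrite (_ : (fun d => _) = fun=> 0) ?Ex_cst ?mulr0 ?addr0; first exact: Cm_min.
  by apply/funext => d; rewrite prednK ?w_last //; lia.
move=> t tT [B HB]; have tT' := ltnW tT; exists (C t (Cm M t) + alpha * B) => y.
apply: lerD; first exact: Cm_min.
rewrite ler_wpM2l // -[B](Ex_cst t); apply: (Ex_mono (adm_demand adm tT')).
- exact: cst_int.
- exact: w_int.
move=> d _; apply: w_ge => // y' _; rewrite ler_wpDl //.
by apply: mulr_ge0; [exact: (adm_K adm) | exact: delta_ge0].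
Qed.

Lemma w_le t x y : (t < T)%N -> x <= y -> w t x <= K t * delta (y - x) + J t y.
Proof.
move=> tT xy; rewrite w_inf // -lerBrDr; apply: ge_inf; last by exists y.
have [B HB] := J_lbound tT; exists (B - c t * x) => _ [y' _ ->].
rewrite lerD2r ler_wpDl //.
by apply: mulr_ge0; [exact: (adm_K adm) | exact: delta_ge0].
Qed.

Lemma w_le_stay t x : (t < T)%N -> w t x <= J t x.
Proof.
move=> tT; have := w_le tT (lexx x).
by rewrite subrr /delta ltxx mulr0 add0r.
Qed.

Lemma w_le_order t x y : (t < T)%N -> x <= y -> w t x <= K t + J t y.
Proof.
move=> tT xy; apply: (le_trans (w_le tT xy)); rewrite lerD2r ler_piMr ?delta_le1 //.
exact: (adm_K adm).
Qed.

(** Any decision available at [y] can be imitated from [x] by ordering to the same level, for at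
    most one additional setup. *)
Lemma w_le_add t x y : (t < T)%N -> x <= y -> w t x <= w t y + K t.
Proof.
move=> tT xy; have K0 := adm_K adm tT; rewrite -lerBlDr; apply: w_ge_cases => //.
  by have := w_le_order tT xy; lra.
by move=> y' yy'; have := @w_le_order t x y' tT; lra.
Qed.

Lemma w_le_policy t x e : (t < T)%N ->
  (x < s t -> J t (S t) <= H t (S t) + e) -> (s t <= x -> J t x <= H t x + e) ->
  w t x <= V t x + e.
Proof.
move=> tT h1 h2; have ok := stages_ok adm tT; have sS := so_sS ok.
have [xs|sx] := ltP x (s t).
  by rewrite Vt_lt //; have := h1 xs; have := @w_le_order t x (S t) tT ltac:(lra); lra.
by rewrite Vt_ge //; have := h2 sx; have := @w_le_stay t x tT; lra.
Qed.

(** No future cost remains, so [J = H], and here [dom] is the whole line: the (s, S) rule is optimal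
    at every real stock. *)
Lemma w_Vt_last x : w T.-1 x = V T.-1 x.
Proof.
have T2 := adm_T adm; have tT : (T.-1 < T)%N by lia.
have JH y : J T.-1 y = H T.-1 y.
  rewrite /J (_ : (fun d => _) = fun=> 0) ?Ex_cst ?mulr0 ?addr0 ?/Ht ?subnn //.
  by apply/funext => d; rewrite prednK ?w_last //; lia.
have ok := stages_ok adm tT; have domT y : dom M T.-1 y by left; lia.
apply/eqP; rewrite eq_le; apply/andP; split.
  by rewrite -[leRHS]addr0; apply: w_le_policy => // _; rewrite JH addr0.
apply: (w_ge_cases tT); first rewrite JH; last move=> y xy; rewrite ?JH.
  by have [xs|sx] := ltP x (s T.-1); [rewrite Vt_lt //; exact: (so_below ok) | rewrite Vt_ge].
have [xs|sx] := ltP x (s T.-1).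
  by rewrite Vt_lt // addrC lerD2l; exact: (so_min ok).
rewrite Vt_ge //; apply: (kconvex_above (adm_K adm tT) (so_S ok) (so_s ok) (so_min ok)
  (so_hs ok) (so_kc ok)) => //; exact: ltW.
Qed.

(** * Cells of shifted points, and the upper bound *)

Lemma cell_shift g y j d g' : isgrid g -> isgrid g' -> y <= g -> z j < d ->
  g' - theta < y - d -> g' <= g - z j.
Proof.
(* Since [y - d < g - z j] with a grid point on the right, the cell of [y - d] cannot end above
   it. *)
move=> gg gg' yg zd h; have gz : isgrid (g - z j) by exact: gridBz.
by rewrite leNgt; apply/negP => lt; have := grid_gap th0 gz gg' lt; lra.
Qed.

(* epsilonbar_t with n = T - 2 - t, in recursive form. *)
Fixpoint eps (n t : nat) (g : R) : R :=
  if n is n'.+1 then 2 * (psid theta t theta (Num.max g (S t)) - gamma t * theta)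
    + alpha * eps n' t.+1 (Num.max g (S t) + theta)
  else alpha * gamma T.-1 * theta.

Lemma St_grid t : (t.+1 < T)%N -> isgrid (S t).
Proof. by move=> tT; apply: (gridP adm tT); exact: so_S (stages_ok adm (ltnW tT)). Qed.

Lemma max_grid g g' : isgrid g -> isgrid g' -> isgrid (Num.max g g').
Proof. by move=> gg gg'; case: (leP g g'). Qed.

Lemma eps_mono n t g g' : (t + n + 2 = T)%N -> isgrid g -> isgrid g' -> g <= g' ->
  eps n t g <= eps n t g'.
Proof.
elim: n t g g' => [//|n IH] t g g' tn gg gg' le_g /=.
have tT : (t.+1 < T)%N by lia.
have gS := St_grid tT; have gm := max_grid gg gS; have gm' := max_grid gg' gS.
have mm : Num.max g (S t) <= Num.max g' (S t).
  by rewrite ge_max !le_max le_g lexx orbT.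
apply: lerD; first by rewrite ler_pM2l // lerD2r; apply: psidth_mono.
rewrite ler_wpM2l //; apply: IH; [lia|exact: gridD1|exact: gridD1|].
by rewrite lerD2r.
Qed.

(** [V_(T-1)] is Lipschitz and rounding moves its argument by at most [theta], so one Lipschitz step
    replaces the argument by cells. *)
Lemma J_le_Ht0 t y : (t.+2 = T)%N -> J t y <= H t y + alpha * gamma T.-1 * theta.
Proof.
move=> tT; have tT1 : (t.+1 < T)%N by lia. have tT' := ltnW tT1.
have e1 := evconst_shift adm y (Vt_lconst M t.+1).
have e2 := evconstD e1 (evconst_cst (gamma T.-1 * theta)).
have hE : Ex M t (fun d => w t.+1 (y - d)) <=
    gsum M t (fun j => V t.+1 (y - z j) + gamma T.-1 * theta).
  apply: (Ex_le_gsum th0 (adm_demand adm tT') e2 (w_int tT' y)) => j d.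
  rewrite (zgS th0) => jd; rewrite (_ : t.+1 = T.-1); last by lia.
  by rewrite w_Vt_last; apply: (Vt_last_lip adm); rewrite ler_norml; lra.
have hL := gsum_lin_ge0 adm (a1 := -1) (a2 := 1) (a3 := 0) (a4 := 0) (d := gamma T.-1 * theta)
  tT' e2 e1 e1 e1 (fun n => ltac:(move=> /=; lra)).
have : Ex M t (fun d => w t.+1 (y - d)) <=
  gsum M t (fun j => V t.+1 (y - z j)) + gamma T.-1 * theta by lra.
move=> /(ler_wpM2l a0); rewrite /J (Ht_rec adm tT1); lra.
Qed.

(** Both [y - d] and [y - z j] lie in the two cells below [g - z j], which costs [2 phibar]; its
    discounted sum is [2 (psibar - gamma_t theta)]. The next error is taken at [g + theta], which
    bounds the cell of [y - d] because [z j >= - theta]. *)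
Lemma J_le_Ht t n g y : (t + n.+1 + 2 = T)%N ->
  (forall x g, isgrid g -> g - theta < x <= g -> w t.+1 x <= V t.+1 x + eps n t.+1 g) ->
  isgrid g -> g - theta < y <= g ->
  J t y <= H t y + (2 * (psid theta t theta g - gamma t * theta) +
    alpha * eps n t.+1 (g + theta)).
Proof.
move=> tn IH gg gy; have tT1 : (t.+1 < T)%N by lia. have tT' := ltnW tT1.
have e1 := evconst_shift adm y (Vt_lconst M t.+1).
have e2 := evconst_shift adm g (phid_lconst adm theta theta tT1).
pose e := eps n t.+1 (g + theta).
have e3 := evconstD (evconstD e1 (evconstZ 2 e2)) (evconst_cst e).
have hE : Ex M t (fun d => w t.+1 (y - d)) <=
    gsum M t (fun j => V t.+1 (y - z j) + 2 * phid theta t.+1 theta (g - z j) + e).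
  apply: (Ex_le_gsum th0 (adm_demand adm tT') e3 (w_int tT' y)) => j d.
  rewrite (zgS th0) => /andP[jd dj].
  have [g' gg' gd] := grid_cell th0 (y - d).
  have hg' : g' <= g - z j.
    by apply: (cell_shift gg gg' (y := y) (d := d)) => //; lra.
  have zj := z_ge adm j.
  have hg : g' <= g + theta by lra.
  have hw := IH _ _ gg' gd.
  have he : eps n t.+1 g' <= e by apply: eps_mono => //; [lia | exact: gridD1].
  have gz : isgrid (g - z j) by exact: gridBz.
  have := @Vt_osc2 _ _ adm t.+1 (g - z j) (y - d) (y - z j) tT1 gz ltac:(lra)
    ltac:(rewrite /cell; lra).
  lra.
have hL := gsum_lin_ge0 adm (a1 := -1) (a2 := 1) (a3 := 2) (a4 := 0) (d := e)
  tT' e3 e1 e2 e1 (fun n => ltac:(move=> /=; lra)).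
have : Ex M t (fun d => w t.+1 (y - d)) <= gsum M t (fun j => V t.+1 (y - z j)) +
  2 * gsum M t (fun j => phid theta t.+1 theta (g - z j)) + e by lra.
move=> /(ler_wpM2l a0); rewrite /J (Ht_rec adm tT1) (psid_rec adm _ _ _ tT1) -/e; lra.
Qed.

(** The policy continues from [S_t] after an order and from [x] otherwise; the maximum of [g] and
    [S_t] covers both by monotonicity. *)
Lemma w_upper n t g x : (t + n + 2 = T)%N -> isgrid g -> g - theta < x <= g ->
  w t x <= V t x + eps n t g.
Proof.
elim: n t g x => [|n IH] t g x tn gg gx.
  by apply: w_le_policy => [|_|_]; [lia | apply: J_le_Ht0; lia..].
have tT : (t.+1 < T)%N by lia. have gS := St_grid tT; have th := th0.
have {}IH x' g' : isgrid g' -> g' - theta < x' <= g' ->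
  w t.+1 x' <= V t.+1 x' + eps n t.+1 g' by apply: IH; lia.
have mono g' : isgrid g' -> g' <= Num.max g (S t) ->
    2 * (psid theta t theta g' - gamma t * theta) + alpha * eps n t.+1 (g' + theta) <=
    eps n.+1 t g.
  move=> gg' le_g /=; have gm := max_grid gg gS.
  apply: lerD; first by rewrite ler_pM2l // lerD2r; apply: psidth_mono.
  by rewrite ler_wpM2l //; apply: eps_mono; [lia|exact: gridD1|exact: gridD1|rewrite lerD2r].
apply: w_le_policy; first exact: ltnW.
  move=> _; have := @J_le_Ht t n (S t) (S t) tn IH gS ltac:(lra).
  by have := mono _ gS ltac:(rewrite le_max lexx orbT //); lra.
move=> _; have := @J_le_Ht t n g x tn IH gg gx.
by have := mono _ gg ltac:(rewrite le_max lexx //); lra.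
Qed.

(** Unrolls [eps] from time [i]: [lam0 g i] is the cell end reached after [i] steps and [alpha ^+ i]
    the discount collected. *)
Lemma eps_sum n i g : alpha ^+ i * eps n i (lam0 M g i) =
  alpha ^+ (i + n).+1 * gamma T.-1 * theta +
  \sum_(i <= j < i + n) 2 * alpha ^+ j *
    (psid theta j theta (Num.max (lam0 M g j) (S j)) - gamma j * theta).
Proof.
elim: n i => [|n IH] i; first by rewrite addn0 big_geq // addr0 /= exprSr; ring.
rewrite big_ltn; last by lia.
have := IH i.+1; rewrite /= addSnnS => h.
by rewrite mulrDr [_ * (alpha * _)]mulrA -exprSr h; ring.
Qed.

Lemma eps_epsbar0 g : eps (T - 2) 0 g = epsbar0 M g.
Proof.
have T2 := adm_T adm; have := eps_sum (T - 2) 0 g.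
rewrite expr0 mul1r /= add0n => ->; rewrite /epsbar0.
by rewrite (_ : (T - 2).+1 = T.-1) //; lia.
Qed.

(** * The error functions and the lower bound *)

Definition omega (t : nat) (x : R) : R := psid 0 t theta x - gamma t * theta +
  alpha * gsum M t (fun j => omegabar M t.+1 (x - z j)).
Definition eta (t : nat) : R := psid theta t theta (SU M t) + omega t (SU M t).

Lemma omegabar_rec t x : (t.+1 < T)%N -> omegabar M t x =
  if x <= SU M t then eta t else Num.max (eta t) (omega t x).
Proof.
by move=> tT; rewrite /eta /omega /omegabar (stage_index adm tT) /= (stage_index adm tT).
Qed.

Lemma omegabar_last x : omegabar M T.-1 x = 0.
Proof. by rewrite /omegabar subnn. Qed.

Lemma omegabar_lconst t : (t < T)%N -> lconst (omegabar M t).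
Proof.
move=> tT; have [tT1|Tt] := ltnP t.+1 T.
  by exists (SU M t), (eta t) => x xS; rewrite omegabar_rec // ltW.
by exists 0, 0 => x _; rewrite (_ : t = T.-1) ?omegabar_last //; lia.
Qed.

Lemma omega_mono_rec t x y : (t.+1 < T)%N ->
  (forall x y, x <= y -> omegabar M t.+1 x <= omegabar M t.+1 y) ->
  x <= y -> omega t x <= omega t y.
Proof.
move=> tT IH xy; have tT' := ltnW tT; rewrite /omega.
have e1 := evconst_shift adm x (omegabar_lconst tT).
have e2 := evconst_shift adm y (omegabar_lconst tT).
apply: lerD.
  by rewrite lerD2r; apply: (psid0_mono adm) => //; rewrite lexx andbT ltW.
rewrite ler_wpM2l //; apply: (gsum_le t th0 e1 e2) => n; apply: IH; lra.
Qed.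

Lemma omegabar_mono t x y : (t < T)%N -> x <= y -> omegabar M t x <= omegabar M t y.
Proof.
move=> tT; move: t tT x y; apply: (back_ind adm) => [x y _|t tT IH x y xy].
  by rewrite !omegabar_last.
have om := omega_mono_rec tT IH xy; rewrite !omegabar_rec //.
case: ifPn => hx; case: ifPn => hy //; first by rewrite le_max lexx.
  by move: hx; rewrite -ltNge; lra.
by rewrite ge_max !le_max lexx om orbT.
Qed.

Lemma omega_mono t x y : (t.+1 < T)%N -> x <= y -> omega t x <= omega t y.
Proof. by move=> tT; apply: omega_mono_rec => // *; exact: omegabar_mono. Qed.

Lemma SU_grid t : (t < T)%N -> isgrid (SU M t).
Proof. by move=> tT; have [] := SU_spec adm tT. Qed.

Lemma eta_le_omegabar t x : (t.+1 < T)%N -> eta t <= omegabar M t x.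
Proof. by move=> tT; rewrite omegabar_rec //; case: ifP => // _; rewrite le_max lexx. Qed.

Lemma omega_le_omegabar t x : (t.+1 < T)%N -> omega t x <= omegabar M t x.
Proof.
move=> tT; rewrite omegabar_rec //; case: ifP => [xS|_]; last by rewrite le_max lexx orbT.
have := omega_mono tT xS; have := psidth_ge0 adm tT (SU_grid (ltnW tT)).
by rewrite /eta; lra.
Qed.

Section Lower.
Context (t : nat) (tT : (t.+1 < T)%N).
Hypothesis IH : forall x g, isgrid g -> g - theta < x <= g ->
  V t.+1 x - omegabar M t.+1 g <= w t.+1 x.
Let tT' : (t < T)%N := ltnW tT.

(** Rounding demand down only raises the stock, by [d - z j <= theta], so the one-sided increment
    bound [phi] applies and [phibar] is avoided. *)
Lemma J_ge_Ht g y : isgrid g -> g - theta < y <= g -> H t y - omega t g <= J t y.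
Proof.
move=> gg gy.
have e1 := evconst_shift adm y (Vt_lconst M t.+1).
have e2 := evconst_shift adm g (phid_lconst adm 0 theta tT).
have e3 := evconst_shift adm g (omegabar_lconst tT).
have e4 := evconstD (evconstD e1 (evconstZ (-1) e2)) (evconstZ (-1) e3).
have hE : gsum M t (fun j => V t.+1 (y - z j) + -1 * phid 0 t.+1 theta (g - z j) +
    -1 * omegabar M t.+1 (g - z j)) <= Ex M t (fun d => w t.+1 (y - d)).
  apply: (gsum_le_Ex th0 (adm_demand adm tT') e4 (w_int tT' y)) => j d.
  rewrite (zgS th0) => /andP[jd dj].
  have [g' gg' gd] := grid_cell th0 (y - d).
  have hg' : g' <= g - z j.
    by apply: (cell_shift gg gg' (y := y) (d := d)) => //; lra.
  have hw := IH gg' gd; have ho := omegabar_mono tT hg'.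
  have := @Vt_incr_le _ _ adm t.+1 (d - z j) (y - z j) tT ltac:(lra).
  rewrite (_ : y - z j - (d - z j) = y - d); last ring.
  have := @phid0_mono _ _ adm t.+1 (d - z j) theta (y - z j) (g - z j) tT
    ltac:(lra) ltac:(lra).
  lra.
have hL := gsum_lin_ge0 adm (a1 := 1) (a2 := -1) (a3 := 1) (a4 := 1) (d := 0)
  tT' e4 e1 e2 e3 (fun n => ltac:(move=> /=; lra)).
have : gsum M t (fun j => V t.+1 (y - z j)) - gsum M t (fun j => phid 0 t.+1 theta (g - z j))
  - gsum M t (fun j => omegabar M t.+1 (g - z j)) <= Ex M t (fun d => w t.+1 (y - d)) by lra.
move=> /(ler_wpM2l a0); rewrite /J /omega (Ht_rec adm tT) (psid_rec adm _ _ _ tT); lra.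
Qed.

(* Starting from the lower end of the cell, not from [y], avoids paying for the
   cell twice in [Ht_le_K_J]. *)
Lemma J_ge_grid g y : isgrid g -> g - theta < y <= g ->
  C t y - C t (g - theta) + H t (g - theta) - psid theta t theta g - omega t g
    + psid 0 t theta g <= J t y.
Proof.
move=> gg gy.
have e1 := evconst_shift adm (g - theta) (Vt_lconst M t.+1).
have e2 := evconst_shift adm g (phid_lconst adm theta theta tT).
have e3 := evconst_shift adm g (omegabar_lconst tT).
have e4 := evconstD (evconstD e1 (evconstZ (-1) e2)) (evconstZ (-1) e3).
have hE : gsum M t (fun j => V t.+1 (g - theta - z j) + -1 * phid theta t.+1 theta (g - z j) +
    -1 * omegabar M t.+1 (g - z j)) <= Ex M t (fun d => w t.+1 (y - d)).
  apply: (gsum_le_Ex th0 (adm_demand adm tT') e4 (w_int tT' y)) => j d.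
  rewrite (zgS th0) => /andP[jd dj].
  have [g' gg' gd] := grid_cell th0 (y - d).
  have hg' : g' <= g - z j.
    by apply: (cell_shift gg gg' (y := y) (d := d)) => //; lra.
  have hw := IH gg' gd; have ho := omegabar_mono tT hg'.
  have gz : isgrid (g - z j) by exact: gridBz.
  have := @Vt_osc_left _ _ adm t.+1 (g - z j) (y - d) tT gz ltac:(lra).
  rewrite (_ : g - z j - theta = g - theta - z j); last ring.
  lra.
have hL := gsum_lin_ge0 adm (a1 := 1) (a2 := -1) (a3 := 1) (a4 := 1) (d := 0)
  tT' e4 e1 e2 e3 (fun n => ltac:(move=> /=; lra)).
have : gsum M t (fun j => V t.+1 (g - theta - z j)) -
    gsum M t (fun j => phid theta t.+1 theta (g - z j))
  - gsum M t (fun j => omegabar M t.+1 (g - z j)) <= Ex M t (fun d => w t.+1 (y - d)) by lra.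
move=> /(ler_wpM2l a0); rewrite /J /omega (Ht_rec adm tT) !(psid_rec adm _ _ _ tT); lra.
Qed.

(** The increment of [C_t] is kept exact instead of being bounded by [gamma_t theta], so that
    convexity can later match it with an increment in a higher cell. *)
Lemma Ht_le_grid g x : isgrid g -> g - theta < x <= g ->
  H t x <= C t x - C t (g - theta) + H t (g - theta) + psid 0 t theta g - gamma t * theta.
Proof.
move=> gg gx.
have e1 := evconst_shift adm x (Vt_lconst M t.+1).
have e2 := evconst_shift adm (g - theta) (Vt_lconst M t.+1).
have e3 := evconst_shift adm g (phid_lconst adm 0 theta tT).
have hn j : V t.+1 (x - z j) - V t.+1 (g - theta - z j) <= phid 0 t.+1 theta (g - z j).
  have := @Vt_incr_le _ _ adm t.+1 (x - (g - theta)) (x - z j) tT ltac:(lra).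
  rewrite (_ : x - z j - (x - (g - theta)) = g - theta - z j); last ring.
  have := @phid0_mono _ _ adm t.+1 (x - (g - theta)) theta (x - z j) (g - z j) tT
    ltac:(lra) ltac:(lra).
  lra.
have hL := gsum_lin_ge0 adm (a1 := -1) (a2 := 1) (a3 := 1) (a4 := 0) (d := 0)
  tT' e1 e2 e3 e1 (fun n => ltac:(have := hn n; lra)).
have {}hL := mulr_ge0 a0 hL.
rewrite !(Ht_rec adm tT) (psid_rec adm _ _ _ tT); lra.
Qed.

Lemma Ex_w_le x y : x <= y ->
  Ex M t (fun d => w t.+1 (x - d)) <= Ex M t (fun d => w t.+1 (y - d)) + K t.+1.
Proof.
move=> xy; rewrite -[K t.+1](Ex_cst t) -(ExD (w_int tT' y) (cst_int t _)).
apply: (Ex_mono (adm_demand adm tT') (w_int tT' x) (intD (w_int tT' y) (cst_int t _))).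
by move=> d _; apply: w_le_add => //; lra.
Qed.

(** Counterpart of [Ht_after_SU] for exact costs at real points, with [w_le_add] in place of
    K-convexity. *)
Lemma J_zn0_le y : SU M t <= y -> J t (zn0 M t) <= J t y.
Proof.
move=> Sy; have zS := zn0_SU adm tT'; have hC := Cf_after_SU adm tT' Sy.
have := @Ex_w_le (zn0 M t) y ltac:(lra) => /(ler_wpM2l a0).
have := adm_KK adm tT; rewrite /J; lra.
Qed.

Lemma J_after_SU x y : zn0 M t <= x -> x <= y -> SU M t <= y -> J t x <= K t + J t y.
Proof.
move=> zx xy Sy; have hC := Cf_zn0_right adm tT' zx xy Sy.
have := Ex_w_le xy => /(ler_wpM2l a0).
have := adm_KK adm tT; rewrite /J; lra.
Qed.

(** Up to [SU], [J_t(y)] is compared with [H_t] at the lower end of the cell of [y]: one oscillation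
    plus [omega_t], both bounded by their values at [SU]. Beyond [SU], [zn0] is no worse. *)
Lemma Ht_St_le_J y : H t (S t) - eta t <= J t y.
Proof.
have gS := SU_grid tT'; have ok := stages_ok adm tT'; have th := th0.
have main y' : y' <= SU M t -> H t (S t) - eta t <= J t y'.
  move=> yS; have [g gg gy] := grid_cell th0 y'.
  have gSU : g <= SU M t.
    by rewrite leNgt; apply/negP => /(grid_gap th0 gS gg); lra.
  have h1 := J_ge_Ht gg gy.
  have h2 := @Ht_osc _ _ adm t g (g - theta) y' tT gg ltac:(rewrite /cell; lra)
    ltac:(rewrite /cell; lra).
  have h3 := so_min ok (dom_grid t (gridB1 gg)).
  have h4 := psidth_mono adm tT gg gS gSU; have h5 := omega_mono tT gSU.
  by rewrite /eta; lra.
have [yS|Sy] := leP y (SU M t); first exact: main.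
by apply: le_trans (J_zn0_le (ltW Sy)); apply: main; have := zn0_SU adm tT'; lra.
Qed.

Lemma Ht_le_K_J g x y : isgrid g -> g - theta < x <= g -> s t <= x -> x < y ->
  y <= SU M t -> H t x - eta t <= K t + J t y.
Proof.
move=> gg gx sx xy yS; have gS := SU_grid tT'; have ok := stages_ok adm tT'.
have th := th0; have gs : isgrid (s t) by apply: (gridP adm tT); exact: so_s ok.
(* If the cell of [x] starts below [s_t], then [x = g = s_t], and [so_hs] reduces the claim to the
   bound at [S_t]. *)
have [sg|gs'] := leP (s t) (g - theta); last first.
  have sg : s t = g.
    apply/eqP; rewrite eq_le; apply/andP; split; first lra.
    by rewrite leNgt; apply/negP => /(grid_gap th0 gs gg); lra.
  have -> : x = s t by lra.
  by have := so_hs ok; have := Ht_St_le_J y; lra.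
have [l gl ly] := grid_cell th0 y.
have lS : l <= SU M t by rewrite leNgt; apply/negP => /(grid_gap th0 gS gl); lra.
have le_gl : g <= l by rewrite leNgt; apply/negP => /(grid_gap th0 gl gg); lra.
have h1 := J_ge_grid gl ly; have h2 := Ht_le_grid gg gx.
have h3 : H t (g - theta) <= K t + H t (l - theta).
  apply: (kconvex_above (adm_K adm tT') (so_S ok) (so_s ok) (so_min ok)
    (so_hs ok) (so_kc ok)) => //; try (apply: dom_grid; exact: gridB1); lra.
(* Convexity of [C_t]: moving up inside the higher cell costs at least as much
   as the same move inside the lower one. *)
have h4 := @convex_incr _ _ (adm_conv adm tT') (g - theta) (l - theta) (y - (l - theta))
  ltac:(lra) ltac:(lra).
rewrite (_ : l - theta + (y - (l - theta)) = y) in h4; last ring.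
have h5 := @lip_le _ _ _ (adm_gamma adm tT') (adm_lip adm tT') x
  (g - theta + (y - (l - theta))) theta ltac:(rewrite ler_norml; lra).
(* The Lipschitz step [h5] is absorbed by [- gamma_t theta] from [Ht_le_grid], and its [psi] at [g]
   by the [psi] at [l] from [J_ge_grid], as [g <= l]. What is left is at most [eta_t]. *)
have h6 := psidth_mono adm tT gl gS lS; have h7 := omega_mono tT lS.
have h8 := @psid0_mono _ _ adm t theta theta g l tT ltac:(lra) le_gl.
by rewrite /eta; lra.
Qed.

Lemma w_lower_step g x : isgrid g -> g - theta < x <= g -> V t x - omegabar M t g <= w t x.
Proof.
move=> gg gx; have gS := SU_grid tT'; have ok := stages_ok adm tT'; have th := th0.
have gs : isgrid (s t) by apply: (gridP adm tT); exact: so_s ok.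
have eo := eta_le_omegabar g tT; have oo := omega_le_omegabar g tT.
have Jx := J_ge_Ht gg gx.
have [xs|sx] := ltP x (s t).
  have gls : g <= s t by rewrite leNgt; apply/negP => /(grid_gap th0 gs gg); lra.
  have gSU : g <= SU M t by have := so_sS ok; have := so_SU ok tT; lra.
  rewrite Vt_lt //; apply: (w_ge_cases tT') => [|y xy]; last by have := Ht_St_le_J y; lra.
  have h1 := @Ht_osc _ _ adm t g (g - theta) x tT gg ltac:(rewrite /cell; lra)
    ltac:(rewrite /cell; lra).
  (* Staying at [x < s_t] is judged at the lower end of its cell, a grid point below [s_t], where
     [H_t] is at least the cost of ordering to [S_t]. *)
  have h2 := so_below ok (dom_grid t (gridB1 gg)) ltac:(lra).
  have h3 := psidth_mono adm tT gg gS gSU; have h4 := omega_mono tT gSU.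
  by move: eo; rewrite /eta; lra.
rewrite Vt_ge //; apply: (w_ge_cases tT') => [|y xy]; first lra.
have [yS|Sy] := leP y (SU M t); first by have := Ht_le_K_J gg gx sx xy yS; lra.
(* For a target beyond [SU]: from [x >= zn0] staying is no worse, and from [x < zn0] the target
   [zn0], which is below [SU], is no worse. *)
have [zx|xz] := leP (zn0 M t) x.
  by have := J_after_SU zx (ltW xy) (ltW Sy); lra.
have := Ht_le_K_J gg gx sx xz (ltW (zn0_SU adm tT')); have := J_zn0_le (ltW Sy).
lra.
Qed.

End Lower.

Lemma w_lower t g x : (t < T)%N -> isgrid g -> g - theta < x <= g ->
  V t x - omegabar M t g <= w t x.
Proof.
move=> tT; move: t tT g x; apply: (back_ind adm) => [g x _ _|t tT IH g x].
  by rewrite w_Vt_last omegabar_last subr0.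
by apply: w_lower_step => // x' g'; exact: IH.
Qed.

End OptimalCost.

Theorem theorem4p7 (R : realType) (M : model R) :
  (2 <= mT M)%N ->
  0 < malpha M <= 1 ->
  (forall t, (t < mT M)%N -> 0 <= mK M t) ->
  (* demands are nonnegative with finite mean *)
  (forall t, (t < mT M)%N -> mmu M t `]-oo, 0[ = 0%E) ->
  (forall t, (t < mT M)%N -> (mmu M t).-integrable setT (fun s => s%:E)) ->
  (* all expectations appearing are finite *)
  (forall t y, (t < mT M)%N ->
     (mmu M t).-integrable setT (fun s => (v M t.+1 (y - s))%:E)) ->
  (* (i) C_t convex and C_t(y) -> +oo as |y| -> oo *)
  (forall t, (t < mT M)%N -> forall x y l, 0 <= l <= 1 ->
     Cf M t (l * x + (1 - l) * y) <= l * Cf M t x + (1 - l) * Cf M t y) ->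
  (forall t, (t < mT M)%N -> forall A, exists B, forall y,
     B <= `|y| -> A <= Cf M t y) ->
  (* (ii) *)
  (forall t, (t.+2 <= mT M)%N -> mK M t >= malpha M * mK M t.+1) ->
  0 < mtheta M ->
  (* Lipschitz constants *)
  (forall t, (t < mT M)%N -> 0 <= mgamma M t) ->
  (forall t, (t < mT M)%N -> forall x y,
     `|Cf M t x - Cf M t y| <= mgamma M t * `|x - y|) ->
  forall (k : int) (x : R), zg M (k - 1) < x <= zg M k ->
    - omegabar M 0 (zg M k) <= v M 0 x - (Vt M 0 x - mc M 0 * x)
    <= epsbar0 M (zg M k).
Proof.
move=> T2 al KO D0 mean int conv coer KK th ga lip k x kx.
have adm := Admissible T2 al KO D0 mean int conv coer KK th ga lip.
have gk : isgrid M (zg M k) by exists k.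
rewrite zg_sub1 in kx.
have lo : Vt M 0 x - omegabar M 0 (zg M k) <= w M 0 x.
  by apply: (w_lower adm) => //; exact: ltnW.
have up : w M 0 x <= Vt M 0 x + eps M (mT M - 2) 0 (zg M k).
  by apply: (w_upper adm) => //; rewrite add0n subnK.
rewrite (eps_epsbar0 adm) in up.
move: lo up; rewrite /w; lra.
Qed.
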